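(* Let $q$ be a power of a prime $p$ and let $\beta\in\mathbb{F}_q((1/z))$ be a formal Laurent series of positive degree. Then the following statements are equivalent: (i) $\beta$ is algebraic over $\mathbb{F}_q(1/z)$; (ii) $d_\beta(1)$ is $p$-automatic; (iii) for any $x\in\mathbb{F}_q[[1/z]]$, $d_\beta(x)$ is $p$-automatic if and only if $x$ is algebraic over $\mathbb{F}_q(1/z)$.
   Context: $\mathbb{F}_q((1/z))$ is the field of formal Laurent series $x=\sum_{n\ge -m}c_nz^{-n}$ with $c_n\in\mathbb{F}_q$, $m\in\mathbb{Z}$; if $c_{-m}\ne0$ then $m$ is called the degree of $x$. $\mathbb{F}_q[[1/z]]$ is the set of series of degree at most $0$ (including $0$). The integer part of $x$ is $[x]=\sum_{-m\le n\le0}c_nz^{-n}\in\mathbb{F}_q[z]$. For $\beta$ of positive degree define $T:\mathbb{F}_q[[1/z]]\to\mathbb{F}_q[[1/z]]$ by $T(x)=\beta x-[\beta x]$, let $T^n$ be its $n$-th iterate and $T^0(x)=x$. For $x\in\mathbb{F}_q[[1/z]]$ put $a_n=[\beta T^{n-1}(x)]\in\mathbb{F}_q[z]$ for $n\ge1$; then $x=\sum_{n\ge1}a_n\beta^{-n}$. The $\beta$-expansion of $x$ is the sequence $d_\beta(x)=\{a_n\}_{n\ge1}$. A sequence $\{a_n\}_{n\ge1}$ is $p$-automatic if its $p$-kernel, i.e. the set of sequences $\{a_{np^i+j+1}\}_{n\ge0}$ with $i\ge0$ and $0\le j<p^i$, is finite. *)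

(* Defs.v *)
From HB Require Import structures.
From mathcomp Require Import all_boot all_order all_algebra.
From mathcomp Require Import generic_quotient fraction.
From mathcomp Require Import mathcomp_extra boolp classical_sets functions.
From mathcomp Require Import cardinality fsbigop.
From mathcomp Require Import zify.

Set Implicit Arguments.
Unset Strict Implicit.
Unset Printing Implicit Defensive.

Import Order.TTheory GRing.Theory Num.Theory.
Local Open Scope quotient_scope.
Local Open Scope ring_scope.

(** * The field F((1/z)) of formal Laurent series in 1/z *)

(* lcoef x n is the coefficient of z^(-n), so that n ranges over the integers
   n >= -m for some m. *)
Record laurent (F : fieldType) := Laurent {
  lcoef :> int -> F;
  lcoef_bounded : exists m : int, forall n : int, n < - m -> lcoef n = 0 }.

HB.instance Definition _ (F : fieldType) := gen_eqMixin (laurent F).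
HB.instance Definition _ (F : fieldType) := gen_choiceMixin (laurent F).

Section Coefficients.
Context {F : fieldType}.
Implicit Types (c d e : int -> F) (x y : laurent F) (a b n : int) (k K : nat).

Lemma laurentP x y : lcoef x =1 lcoef y <-> x = y.
Proof.
split=> [|-> //]; case: x y => [c hc] [d hd] /= /funext cd.
by case: _ / cd hd => hd; congr Laurent; exact: Prop_irrelevance.
Qed.

Definition vanish_below a c := forall n, n < a -> c n = 0.

Lemma vanish_le a b c : a <= b -> vanish_below b c -> vanish_below a c.
Proof. by move=> ab cb n na; apply: cb; apply: lt_le_trans ab. Qed.

Lemma lcoef_vanish x : exists a, vanish_below a x.
Proof. by case: (lcoef_bounded x) => m xm; exists (- m). Qed.

Lemma vanish_bounded a c :
  vanish_below a c -> exists m : int, forall n : int, n < - m -> c n = 0.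
Proof. by exists (- a) => n; rewrite opprK; exact: H. Qed.

Lemma vanish2 x y : exists a, vanish_below a x /\ vanish_below a y.
Proof.
case: (lcoef_vanish x) (lcoef_vanish y) => [a xa] [b yb].
exists (Num.min a b); split.
  by apply: vanish_le xa; rewrite ge_min lexx.
by apply: vanish_le yb; rewrite ge_min lexx orbT.
Qed.

(* Cauchy product; the sum has finite support for Laurent series. *)
Definition conv c d n : F := \sum_(i \in [set: int]%classic) c i * d (n - i).

Lemma conv_below a b c d :
  vanish_below a c -> vanish_below b d -> vanish_below (a + b) (conv c d).
Proof.
move=> ca db n nab; rewrite /conv fsbig1 // => i _.
have [ia|ai] := ltP i a; first by rewrite ca // mul0r.
by rewrite db ?mulr0 //; lia.
Qed.

Lemma convE a b c d k : vanish_below a c -> vanish_below b d ->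
  conv c d (a + b + k%:Z) =
  \sum_(j < k.+1) c (a + j%:Z) * d (b + (k - j)%N%:Z).
Proof.
move=> ca db; rewrite /conv.
rewrite (fsbigE [seq a + j%:Z | j <- iota 0 k.+1]) //.
- rewrite big_mkcond big_map -{1}[k.+1]subn0 -/(index_iota 0 k.+1) big_mkord.
  apply: eq_bigr => j _; rewrite in_setT; congr (_ * d _).
  have := ltn_ord j; lia.
- by rewrite map_inj_uniq ?iota_uniq // => i j /addrI [].
move=> i _ /negP hi.
have [ia|ai] := ltP i a; first by rewrite ca // mul0r.
rewrite db ?mulr0 //; rewrite ltNge; apply/negP => bi; apply: hi.
apply/mapP; exists `|i - a|%N; last by lia.
rewrite mem_iota; lia.
Qed.

Definition trunc K a c : {poly F} := \poly_(k < K) c (a + k%:Z).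

Lemma conv_trunc a b c d k K :
    vanish_below a c -> vanish_below b d -> (k < K)%N ->
  conv c d (a + b + k%:Z) = (trunc K a c * trunc K b d)`_k.
Proof.
move=> ca db kK; rewrite (convE k ca db) coefM.
apply: eq_bigr => j _; have jk := ltn_ord j.
by rewrite !coef_poly !ifT //; lia.
Qed.

Lemma int_split a n : a <= n -> exists k : nat, n = a + k%:Z.
Proof. by move=> an; exists `|n - a|%N; lia. Qed.

Lemma convC x y : conv x y =1 conv y x.
Proof.
move=> n; case: (lcoef_vanish x) (lcoef_vanish y) => [a xa] [b yb].
have [nab|/int_split [k ->]] := ltP n (a + b).
  by rewrite (conv_below xa yb) // (conv_below yb xa) // addrC.
rewrite (conv_trunc xa yb (ltnSn k)) mulrC -(conv_trunc yb xa (ltnSn k)).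
by rewrite [b + a]addrC.
Qed.

Lemma convA x y (z : laurent F) : conv x (conv y z) =1 conv (conv x y) z.
Proof.
move=> n; case: (lcoef_vanish x) (lcoef_vanish y) (lcoef_vanish z) =>
  [a xa] [b yb] [c zc].
have xyab := conv_below xa yb; have yzbc := conv_below yb zc.
have [nab|/int_split [k ->]] := ltP n (a + (b + c)).
  by rewrite (conv_below xa yzbc) // (conv_below xyab zc) // -addrA.
rewrite (conv_trunc xa yzbc (ltnSn k)) addrA (conv_trunc xyab zc (ltnSn k)).
pose P := trunc k.+1 a x; pose Q := trunc k.+1 b y; pose R := trunc k.+1 c z.
have -> : (P * trunc k.+1 (b + c) (conv y z))`_k = (P * (Q * R))`_k.
  rewrite !coefM; apply: eq_bigr => j _; congr (_ * _); have jk := ltn_ord j.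
  by rewrite coef_poly ifT ?(conv_trunc yb zc (K := k.+1)) //; lia.
have -> // : (trunc k.+1 (a + b) (conv x y) * R)`_k = (P * Q * R)`_k.
  rewrite !coefM; apply: eq_bigr => j _; congr (_ * _); have jk := ltn_ord j.
  by rewrite coef_poly ifT ?(conv_trunc xa yb (K := k.+1)).
by rewrite mulrA.
Qed.

Lemma mono_vanish i : vanish_below i (fun n => (n == i)%:R : F).
Proof. by move=> n ni; rewrite lt_eqF. Qed.

Lemma conv_mono i x n : conv (fun n => (n == i)%:R) x n = x (n - i).
Proof.
rewrite /conv (fsbigE [:: i]) //.
  by rewrite big_mkcond big_seq1 in_setT eqxx mul1r.
by move=> j _; rewrite inE => /negPf ->; rewrite mul0r.
Qed.

End Coefficients.

Section Operations.
Context {F : fieldType}.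
Implicit Types (x y : laurent F).

Fact ladd_bounded x y :
  exists m : int, forall n : int, n < - m -> x n + y n = 0.
Proof.
case: (vanish2 x y) => a [xa ya]; apply: (@vanish_bounded F a) => n na.
by rewrite xa // ya // addr0.
Qed.
Definition ladd x y := Laurent (ladd_bounded x y).

Fact lopp_bounded x : exists m : int, forall n : int, n < - m -> - x n = 0.
Proof.
by case: (lcoef_bounded x) => m xm; exists m => n /xm ->; rewrite oppr0.
Qed.
Definition lopp x := Laurent (lopp_bounded x).

Fact lscale_bounded (a : F) x :
  exists m : int, forall n : int, n < - m -> a * x n = 0.
Proof.
by case: (lcoef_bounded x) => m xm; exists m => n /xm ->; rewrite mulr0.
Qed.
Definition lscale a x := Laurent (lscale_bounded a x).

Fact lmul_bounded x y :
  exists m : int, forall n : int, n < - m -> conv x y n = 0.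
Proof.
case: (lcoef_vanish x) (lcoef_vanish y) => [a xa] [b yb].
exact: vanish_bounded (conv_below xa yb).
Qed.
Definition lmul x y := Laurent (lmul_bounded x y).

Fact lzero_bounded : exists m : int, forall n : int, n < - m -> 0 = 0 :> F.
Proof. by exists 0. Qed.
Definition lzero := Laurent lzero_bounded.

Definition lmono (i : int) := Laurent (vanish_bounded (@mono_vanish F i)).

Fact laddA : associative ladd.
Proof. by move=> x y z; apply/laurentP => n /=; rewrite addrA. Qed.
Fact laddC : commutative ladd.
Proof. by move=> x y; apply/laurentP => n /=; rewrite addrC. Qed.
Fact ladd0 : left_id lzero ladd.
Proof. by move=> x; apply/laurentP => n /=; rewrite add0r. Qed.
Fact laddN : left_inverse lzero lopp ladd.
Proof. by move=> x; apply/laurentP => n /=; rewrite addNr. Qed.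

Fact lmulA : associative lmul.
Proof. by move=> x y z; apply/laurentP => n /=; exact: convA. Qed.
Fact lmulC : commutative lmul.
Proof. by move=> x y; apply/laurentP => n /=; exact: convC. Qed.
Fact lmul1 : left_id (lmono 0) lmul.
Proof. by move=> x; apply/laurentP => n /=; rewrite conv_mono subr0. Qed.
Fact lmulDl : left_distributive lmul ladd.
Proof.
move=> x y z; apply/laurentP => n /=.
case: (vanish2 x y) (lcoef_vanish z) => [a [xa ya]] [b zb].
have xya : vanish_below a (ladd x y).
  by move=> i ia /=; rewrite xa // ya // addr0.
have [nab|/int_split [k ->]] := ltP n (a + b).
  by rewrite (conv_below xya zb) // (conv_below xa zb) // (conv_below ya zb) //
             addr0.
rewrite (convE k xya zb) (convE k xa zb) (convE k ya zb) -big_split /=.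
by apply: eq_bigr => j _; rewrite mulrDl.
Qed.
Fact lone_neq0 : lmono 0 != lzero.
Proof. by apply/eqP => /laurentP /(_ 0) /eqP; rewrite /= oner_eq0. Qed.

End Operations.

HB.instance Definition _ (F : fieldType) :=
  GRing.isZmodule.Build (laurent F) laddA laddC ladd0 laddN.
HB.instance Definition _ (F : fieldType) :=
  GRing.Zmodule_isComNzRing.Build (laurent F)
    lmulA lmulC lmul1 lmulDl lone_neq0.

Section Inverse.
Context {F : fieldType}.
Implicit Types (x y : laurent F).

Lemma lcoefD x y n : (x + y) n = x n + y n. Proof. by []. Qed.
Lemma lcoefN x n : (- x) n = - x n. Proof. by []. Qed.
Lemma lcoef0 n : (0 : laurent F) n = 0. Proof. by []. Qed.
Lemma lcoefB x y n : (x - y) n = x n - y n. Proof. by []. Qed.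
Lemma lcoef1 n : (1 : laurent F) n = (n == 0)%:R. Proof. by []. Qed.
Lemma lcoefM x y n :
  (x * y) n = \sum_(i \in [set: int]%classic) x i * y (n - i).
Proof. by []. Qed.

Lemma laurent_valuation x :
  x != 0 -> exists2 v : int, x v != 0 & vanish_below v x.
Proof.
move=> x0; case: (lcoef_vanish x) => a xa.
have exk : exists k : nat, x (a + k%:Z) != 0.
  apply: contrapT => hk; case/negP: x0; apply/eqP/laurentP => n.
  have [na|/int_split [k ->]] := ltP n a; first exact: xa.
  by apply/eqP/negPn/negP => xk; apply: hk; exists k.
case: (ex_minnP exk) => k xk kmin; exists (a + k%:Z) => // n nk.
have [na|/int_split [l nl]] := ltP n a; first exact: xa.
apply/eqP/negPn/negP => xn; have := kmin l; rewrite -nl => /(_ xn); lia.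
Qed.

Lemma series_inverse (c : nat -> F) : c 0%N != 0 ->
  exists e : nat -> F,
    forall k, \sum_(j < k.+1) c j * e (k - j)%N = (k == 0%N)%:R.
Proof.
move=> c0.
pose next s : F := let n := size s in
  ((n == 0%N)%:R - \sum_(j < n) c j.+1 * s`_(n - j.+1)) / c 0%N.
pose es := fix es n := if n is n'.+1 then rcons (es n') (next (es n')) else [::].
have size_es n : size (es n) = n by elim: n => //= n IH; rewrite size_rcons IH.
pose e k := next (es k).
have esE n k : (k < n)%N -> (es n)`_k = e k.
  elim: n => // n IH; rewrite ltnS leq_eqVlt => /orP [/eqP ->|kn] /=.
    by rewrite nth_rcons size_es ltnn eqxx.
  by rewrite nth_rcons size_es kn IH.
exists e => k; rewrite big_ord_recl subn0 {1}/e /next size_es mulrC divfK //.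
rewrite -[RHS](subrK (\sum_(j < k) c j.+1 * (es k)`_(k - j.+1))); congr (_ + _).
apply: eq_bigr => j _; rewrite esE //; have := ltn_ord j; lia.
Qed.

Lemma linv_ex x : exists y, if x == 0 then y = 0 else y * x = 1.
Proof.
have [_|/laurent_valuation [v xv xlt]] := eqVneq x 0; first by exists 0.
have [|e he] := @series_inverse (fun j => x (v + j%:Z)).
  by rewrite addr0.
pose d (n : int) := if n < - v then 0 else e (absz (n + v)).
have dv : vanish_below (- v) d by move=> n nv; rewrite /d nv.
exists (Laurent (vanish_bounded dv)); rewrite mulrC; apply/laurentP => n.
rewrite lcoef1 -[LHS]/(conv x d n).
have [n0|/int_split [k ->]] := ltP n 0.
  by rewrite (conv_below xlt dv) ?subrr // lt_eqF.
rewrite -{1}(subrr v) (convE k xlt dv) add0r (_ : (k%:Z == 0) = (k == 0%N)) // -he.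
apply: eq_bigr => j _; congr (_ * _); have jk := ltn_ord j.
rewrite /d ifF; last by lia.
congr e; lia.
Qed.

Definition linv x : laurent F := sval (cid (linv_ex x)).

Fact lmulVx x : x != 0 -> linv x * x = 1.
Proof. by rewrite /linv; case: cid => y /=; case: eqP. Qed.
Fact linv0 : linv 0 = 0.
Proof. by rewrite /linv; case: cid => y /=; rewrite eqxx. Qed.

End Inverse.

HB.instance Definition _ (F : fieldType) :=
  GRing.ComNzRing_isField.Build (laurent F) lmulVx linv0.

(** ** The F-algebra structure *)

Section Algebra.
Context {F : fieldType}.
Implicit Types (x y : laurent F).

Fact lscaleA (a b : F) x : lscale a (lscale b x) = lscale (a * b) x.
Proof. by apply/laurentP => n /=; rewrite mulrA. Qed.
Fact lscale1 : left_id 1 (@lscale F).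
Proof. by move=> x; apply/laurentP => n /=; rewrite mul1r. Qed.
Fact lscaleDr : right_distributive (@lscale F) +%R.
Proof. by move=> a x y; apply/laurentP => n /=; rewrite mulrDr. Qed.
Fact lscaleDl x : {morph (@lscale F)^~ x : a b / a + b}.
Proof. by move=> a b; apply/laurentP => n /=; rewrite mulrDl. Qed.

End Algebra.

HB.instance Definition _ (F : fieldType) :=
  GRing.Zmodule_isLmodule.Build F (laurent F)
    lscaleA lscale1 lscaleDr lscaleDl.

Fact lscaleAl (F : fieldType) (a : F) (x y : laurent F) :
  a *: (x * y) = (a *: x) * y.
Proof.
apply/laurentP => n; rewrite /GRing.scale /= /conv mulr_fsumr.
by apply: eq_fsbigr => i _; rewrite mulrA.
Qed.

HB.instance Definition _ (F : fieldType) :=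
  GRing.Lmodule_isLalgebra.Build F (laurent F) (@lscaleAl F).

Fact lscaleAr (F : fieldType) (a : F) (x y : laurent F) :
  a *: (x * y) = x * (a *: y).
Proof. by rewrite mulrC lscaleAl mulrC. Qed.

HB.instance Definition _ (F : fieldType) :=
  GRing.Lalgebra_isAlgebra.Build F (laurent F) (@lscaleAr F).

(** * Polynomials and rational functions inside F((1/z)) *)

Definition lz {F : fieldType} : laurent F := lmono (-1).

(* r(X) |-> r(1/z), the embedding of the field F(1/z) in F((1/z)). *)
Definition rat_invz {F : fieldType} (r : {fraction {poly F}}) : laurent F :=
  horner_alg lz^-1 \n_(repr r) / horner_alg lz^-1 \d_(repr r).

Section Embeddings.
Context {F : fieldType}.
Implicit Types (x y : laurent F) (p q : {poly F}).

Lemma lcoefZ (a : F) x n : (a *: x) n = a * x n. Proof. by []. Qed.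

Lemma lcoef_sum (I : Type) (r : seq I) (P : pred I) (G : I -> laurent F) n :
  (\sum_(i <- r | P i) G i) n = \sum_(i <- r | P i) (G i) n.
Proof.
by elim/big_rec2: _ => [|i a x _ <-]; rewrite ?lcoef0 ?lcoefD.
Qed.

Lemma lmonoM i j : lmono i * lmono j = lmono (i + j) :> laurent F.
Proof.
apply/laurentP => n; rewrite -[LHS]/(conv _ _ n) conv_mono /=.
by rewrite subr_eq addrC.
Qed.

Lemma lmonoX i (k : nat) : lmono i ^+ k = lmono (i * k%:Z) :> laurent F.
Proof.
elim: k => [|k IH]; first by rewrite expr0 mulr0.
by rewrite exprS IH lmonoM; congr lmono; lia.
Qed.

Lemma lz_neq0 : lz != 0 :> laurent F.
Proof. by apply/eqP => /laurentP /(_ (-1)) /eqP; rewrite /= oner_eq0. Qed.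

Lemma lzV : lz^-1 = lmono 1 :> laurent F.
Proof.
by apply: (mulfI lz_neq0); rewrite divff ?lz_neq0 // lmonoM.
Qed.

Lemma horner_alg_lmono i p :
  horner_alg (lmono i) p = \sum_(k < size p) p`_k *: lmono (i * k%:Z).
Proof.
rewrite -{1}[p]coefK poly_def linear_sum; apply: eq_bigr => k _.
by rewrite -mul_polyC rmorphM rmorphXn /= horner_algC
           horner_algX lmonoX mulr_algl.
Qed.

Lemma lcoef_polyz p n :
  (horner_alg lz p) n = if n <= 0 then p`_`|n|%N else 0.
Proof.
rewrite horner_alg_lmono lcoef_sum; under eq_bigr do rewrite lcoefZ.
case: ifPn => hn; last first.
  by rewrite big1 // => k _ /=; rewrite (_ : _ == _ = false) ?mulr0 //; lia.
have [lt_np|le_pn] := ltnP `|n|%N (size p).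
  rewrite (bigD1 (Ordinal lt_np)) //= big1 ?addr0.
    by rewrite (_ : _ == _ = true) ?mulr1 //; lia.
  move=> [k kp]; rewrite -val_eqE /= => hk.
  by rewrite (_ : _ == _ = false) ?mulr0 //; lia.
rewrite nth_default // big1 // => -[k kp] _ /=; have hk := leq_trans kp le_pn.
by rewrite (_ : _ == _ = false) ?mulr0 //; lia.
Qed.

Lemma lcoef_polyzV p (n : nat) : (horner_alg lz^-1 p) n = p`_n.
Proof.
rewrite lzV horner_alg_lmono lcoef_sum; under eq_bigr do rewrite lcoefZ.
have [lt_np|le_pn] := ltnP n (size p).
  rewrite (bigD1 (Ordinal lt_np)) //= big1 ?addr0.
    by rewrite (_ : _ == _ = true) ?mulr1 //; lia.
  move=> [k kp]; rewrite -val_eqE /= => hk.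
  by rewrite (_ : _ == _ = false) ?mulr0 //; lia.
rewrite nth_default // big1 // => -[k kp] _ /=; have hk := leq_trans kp le_pn.
by rewrite (_ : _ == _ = false) ?mulr0 //; lia.
Qed.

Lemma polyzV_eq0 p : (horner_alg lz^-1 p == 0 :> laurent F) = (p == 0).
Proof.
apply/eqP/eqP => [p0|->]; last exact: rmorph0.
by apply/polyP => n; rewrite -lcoef_polyzV p0 coef0.
Qed.

Lemma fraction_repr (r : {fraction {poly F}}) :
  r = FracField.tofrac \n_(repr r) / FracField.tofrac \d_(repr r).
Proof.
have piM (s : {ratio {poly F}}) :
    \pi_{fraction {poly F}} s * FracField.tofrac \d_s = FracField.tofrac \n_s.
  rewrite -[LHS]/(FracField.mul _ _) !piE; apply/eqmodP.
  rewrite /= /FracField.equivf /FracField.mulf !numden_Ratio ?oner_eq0 ?mulr1 //;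
    do ?exact: denom_ratioP.
  by rewrite mulrC.
by rewrite -piM reprK mulfK // tofrac_eq0 denom_ratioP.
Qed.

Lemma rat_invz_div p q : q != 0 ->
  rat_invz (FracField.tofrac p / FracField.tofrac q) =
  horner_alg lz^-1 p / horner_alg lz^-1 q.
Proof.
move=> q0; rewrite /rat_invz.
have := fraction_repr (FracField.tofrac p / FracField.tofrac q).
set r := repr _; have r0 : \d_r != 0 by exact: denom_ratioP.
move/eqP; rewrite eqr_div ?tofrac_eq0 // -!rmorphM tofrac_eq => /eqP pqr.
by apply/eqP; rewrite eqr_div ?polyzV_eq0 // -!rmorphM pqr.
Qed.

Fact rat_invz_zmod_morphism : zmod_morphism (@rat_invz F).
Proof.
move=> r s; rewrite [r]fraction_repr [s]fraction_repr.
move: (denom_ratioP (repr r)) (denom_ratioP (repr s)).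
move: {r s}(\n_(repr r)) (\d_(repr r)) (\n_(repr s)) (\d_(repr s)).
move=> a b c d b0 d0; rewrite -mulNr -rmorphN addf_div ?tofrac_eq0 //.
rewrite -!rmorphM -rmorphD !rat_invz_div ?mulf_neq0 //.
rewrite -[in RHS]mulNr -[in RHS]rmorphN addf_div ?polyzV_eq0 //.
by rewrite -!rmorphM -rmorphD.
Qed.

Fact rat_invz_monoid_morphism : monoid_morphism (@rat_invz F).
Proof.
split=> [|r s].
  by rewrite -[1]divr1 -{1 2}(rmorph1 (@FracField.tofrac {poly F}))
             rat_invz_div ?oner_eq0 // rmorph1 divr1.
rewrite [r]fraction_repr [s]fraction_repr.
move: (denom_ratioP (repr r)) (denom_ratioP (repr s)).
move: {r s}(\n_(repr r)) (\d_(repr r)) (\n_(repr s)) (\d_(repr s)).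
move=> a b c d b0 d0; rewrite mulf_div -!rmorphM !rat_invz_div ?mulf_neq0 //.
by rewrite mulf_div -!rmorphM.
Qed.

End Embeddings.

HB.instance Definition _ (F : fieldType) :=
  GRing.isZmodMorphism.Build {fraction {poly F}} (laurent F) (@rat_invz F)
    (@rat_invz_zmod_morphism F).
HB.instance Definition _ (F : fieldType) :=
  GRing.isMonoidMorphism.Build {fraction {poly F}} (laurent F) (@rat_invz F)
    (@rat_invz_monoid_morphism F).

(** * Degree and integer part *)

Section IntegerPart.
Context {F : fieldType}.
Implicit Types (x : laurent F) (m n : int).

Definition has_degree x m := x (- m) != 0 /\ forall n, n < - m -> x n = 0.

(* F[[1/z]]. *)
Definition int_series : set (laurent F) :=
  [set x | x = 0 \/ exists2 m, m <= 0 & has_degree x m]%classic.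

Lemma int_seriesP x : int_series x <-> forall n, n < 0 -> x n = 0.
Proof.
split=> [[-> //|[m m0 [_ xm]] n n0]|x0]; first by apply: xm; lia.
have [->|/laurent_valuation [v xv vx]] := eqVneq x 0; first by left.
right; exists (- v); last by split; rewrite opprK.
by rewrite oppr_le0 leNgt; apply/negP => /x0 /eqP; apply/negP.
Qed.

Fact ipart_bounded x :
  exists N : nat, forall k : nat, (N <= k)%N -> x (- k%:Z) = 0.
Proof.
case: (lcoef_bounded x) => m xm; exists `|m|.+1%N => k mk; apply: xm; lia.
Qed.

(* The integer part [x], as a polynomial in z. *)
Definition ipart x : {poly F} :=
  \poly_(k < sval (cid (ipart_bounded x))) x (- k%:Z).

Lemma coef_ipart x (k : nat) : (ipart x)`_k = x (- k%:Z).
Proof.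
rewrite /ipart; case: cid => N xN /=; rewrite coef_poly.
by case: ltnP => // /xN.
Qed.

End IntegerPart.

(** * beta-expansions *)

Section BetaExpansion.
Context {F : fieldType}.
Implicit Types (beta x : laurent F).

Definition beta_map beta x : laurent F :=
  beta * x - horner_alg lz (ipart (beta * x)).

(* Digit sequence, indexed from 1; the value at 0 is meaningless. *)
Definition beta_expansion beta x (n : nat) : {poly F} :=
  ipart (beta * iter n.-1 (beta_map beta) x).

Lemma beta_map_coef beta x (n : int) :
  beta_map beta x n = if n <= 0 then 0 else (beta * x) n.
Proof.
rewrite /beta_map lcoefB lcoef_polyz coef_ipart; case: ifPn => n0.
  by rewrite (_ : - _ = n) ?subrr //; lia.
by rewrite subr0.
Qed.

Lemma beta_map_int_series beta x : int_series (beta_map beta x).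
Proof. by apply/int_seriesP => n n0; rewrite beta_map_coef ltW. Qed.

End BetaExpansion.

(** * Automatic sequences *)

(* Sequences are again indexed from 1. *)
Definition pkernel {A : Type} (p : nat) (a : nat -> A) : set (nat -> A) :=
  [set u | exists i, exists2 j, (j < p ^ i)%N &
           u = fun n => a (n * p ^ i + j + 1)%N]%classic.

Definition automatic {A : Type} (p : nat) (a : nat -> A) : Prop :=
  finite_set (pkernel p a).

(* Main.v *)
(** Let t = 1/z, s = 1/beta, m = deg beta, and let psi be the continuous
    F-algebra endomorphism of F((1/z)) sending t to s.  The field F((1/z)) has
    the basis 1, t, ..., t^(m-1) over the image of psi.  Grouping the digits by
    powers of z writes x = sum_k z^k psi(H_k), where H_k is the power series in
    t whose n-th coefficient is the coefficient of z^k in the n-th digit.  By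
    Christol's theorem the expansion is automatic iff all H_k are algebraic.

    If beta is algebraic and the H_k are, then so are the psi(H_k), hence x.
    Conversely let beta and x be algebraic.  Cartier operators give x = b g with
    g = sum_i a_i g^(q^(i+1)) and b, a_i in F[t].  The coordinates over psi of
    g, g^q, g^(q^2), ... then form a finite family contained in the span of its
    own q-th powers, with algebraic coefficients, because the minimal polynomial
    of t over the image of psi divides a polynomial over psi(F(t)); such a
    family consists of algebraic elements.  No separability of beta is needed.

    If the expansion of 1 is automatic, then 1 = sum_k z^k psi(H_k) is an
    equation of degree m for z with coefficients algebraic over F(beta), so z is
    algebraic over F(beta), and thus beta over F(z). *)

Require Import Defs.
From HB Require Import structures.
From mathcomp Require Import all_boot all_order all_algebra all_field.
From mathcomp Require Import generic_quotient fraction.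
From mathcomp Require Import boolp classical_sets functions cardinality fsbigop.
From mathcomp Require Import zify ring.

Set Implicit Arguments.
Unset Strict Implicit.
Unset Printing Implicit Defensive.

Import Order.TTheory GRing.Theory Num.Theory.
Local Open Scope ring_scope.

(** * Algebraic elements *)

Section Algebraic.
Context {E K : fieldType} (phi : {rmorphism E -> K}).
Implicit Types (x y : K) (P : {poly K}).

Lemma algebraic_sum (I : Type) (r : seq I) (A : pred I) (G : I -> K) :
  (forall i, A i -> algebraicOver phi (G i)) ->
  algebraicOver phi (\sum_(i <- r | A i) G i).
Proof.
move=> algG; elim/big_rec: _ => [|i x Ai algx]; first exact: algebraic0.
exact: algebraic_add (algG i Ai) algx.
Qed.

Lemma algebraic_exp x n : algebraicOver phi x -> algebraicOver phi (x ^+ n).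
Proof.
move=> algx; elim: n => [|n IH]; first exact: algebraic1.
by rewrite exprS; exact: algebraic_mul.
Qed.

Lemma algebraic_horner P x :
  (forall i, algebraicOver phi P`_i) -> algebraicOver phi x ->
  algebraicOver phi P.[x].
Proof.
move=> algP algx; rewrite horner_coef; apply: algebraic_sum => i _.
by apply: algebraic_mul (algP i) _; exact: algebraic_exp.
Qed.

Lemma algebraic_root P x :
  P != 0 -> root P x -> (forall i, algebraicOver phi P`_i) ->
  algebraicOver phi x.
Proof.
move=> P0 Px algP; apply/integral_algebraic; apply: (integral_root P0 Px).
by move=> _ /(nthP 0) [i _ <-]; apply/integral_algebraic.
Qed.

Lemma algebraic_rmorph (L : fieldType) (rho : {rmorphism K -> L}) x :
  algebraicOver (rho \o phi) (rho x) <-> algebraicOver phi x.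
Proof.
by split=> -[P P0 Px]; exists P => //; move: Px;
  rewrite map_poly_comp fmorph_root.
Qed.

End Algebraic.

Lemma algebraic_trans (E E' K : fieldType) (phi : {rmorphism E -> K})
    (chi : {rmorphism E' -> K}) x :
  (forall a, algebraicOver phi (chi a)) -> algebraicOver chi x ->
  algebraicOver phi x.
Proof.
move=> algchi [P P0 Px]; apply: (algebraic_root _ Px).
  by rewrite map_poly_eq0.
by move=> i; rewrite coef_map; exact: algchi.
Qed.

Section AlgebraicClosure.
Context {E K : fieldType} (phi : {rmorphism E -> K}).

Definition alg_pred : {pred K} := [pred x | `[< algebraicOver phi x >]].

Fact alg_pred_divring : GRing.divring_closed alg_pred.
Proof.
split=> [|x y|x y].
- by apply/asboolP; exact: algebraic1.
- by move=> /asboolP ? /asboolP ?; apply/asboolP; exact: algebraic_sub.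
- by move=> /asboolP ? /asboolP ?; apply/asboolP; exact: algebraic_div.
Qed.
HB.instance Definition _ :=
  GRing.isDivringClosed.Build K alg_pred alg_pred_divring.

Record alg_closure := AlgClosure {
  alg_val : K; alg_valP : alg_val \in alg_pred }.
HB.instance Definition _ := [isSub for alg_val].
HB.instance Definition _ := [Choice of alg_closure by <:].
HB.instance Definition _ :=
  [SubChoice_isSubIntegralDomain of alg_closure by <:].
HB.instance Definition _ := [SubIntegralDomain_isSubField of alg_closure by <:].

(** Makes the algebraic elements a field of their own, over which polynomials can be divided and
    [frobenius_span_algebraic] applied. *)
Lemma relative_algebraic_closure :
  exists (A : fieldType) (incl : {rmorphism A -> K}),
    forall x, algebraicOver phi x <-> exists a, incl a = x.
Proof.
exists alg_closure, val => x; split=> [/asboolP algx|[a <-]].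
  by exists (AlgClosure algx).
exact/asboolP/alg_valP.
Qed.

End AlgebraicClosure.

Lemma map_poly_lift (A K : fieldType) (incl : {rmorphism A -> K})
    (P : {poly K}) :
  (forall i, exists a, incl a = P`_i) -> exists P', map_poly incl P' = P.
Proof.
move=> /choice [f fP]; exists (\poly_(i < size P) f i); apply/polyP => i.
rewrite coef_map coef_poly; case: ltnP => [_|leP]; first exact: fP.
by rewrite raddf0 nth_default.
Qed.

Lemma irreducible_divisor (K : fieldType) (P : {poly K}) :
  (1 < size P)%N -> exists2 Q, irreducible_poly Q & Q %| P.
Proof.
have [n] := ubnP (size P); elim: n P => // n IH P ltn gt1.
case: (pselect (irreducible_poly P)) => [|redP]; first by exists P.
have [Q [Q1 QP QnP]] : exists Q : {poly K},
    [/\ size Q != 1%N, Q %| P & ~~ (Q %= P)].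
  apply: contrapT => hQ; apply: redP; split=> // Q Q1 QP.
  by apply/negPn/negP => QnP; apply: hQ; exists Q.
have P0 : P != 0 by rewrite -size_poly_gt0 ltnW.
have Q0 : Q != 0 by exact: dvdpN0 QP P0.
have ltQP : (size Q < size P)%N.
  by rewrite ltn_neqAle dvdp_leq // andbT; move: QnP; rewrite dvdp_size_eqp.
case: (IH Q) => [||R irrR RQ]; first exact: leq_trans ltQP _.
  by rewrite ltn_neqAle eq_sym Q1 size_poly_gt0.
by exists R => //; exact: dvdp_trans RQ QP.
Qed.

Lemma root_in_extension (K : fieldType) (P : {poly K}) : (1 < size P)%N ->
  exists (L : fieldType) (rho : {rmorphism K -> L}) (x : L),
    root (map_poly rho P) x.
Proof.
move=> /irreducible_divisor [Q irrQ QP].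
have [L _ [x Qx _]] := irredp_FAdjoin irrQ.
exists L, (in_alg L), x; move: Qx; rewrite -!dvdp_XsubCl => /dvdp_trans; apply.
by rewrite dvdp_map.
Qed.

(** Roots of [Q] in an extension are roots of [P], hence algebraic, and they determine the
    coefficients of the monic [Q]. One root is adjoined and split off at a time, so the field [K]
    varies in the induction. *)
Lemma dvdp_coef_algebraic (E K : fieldType) (phi : {rmorphism E -> K})
    (P : {poly E}) (Q : {poly K}) :
  P != 0 -> Q \is monic -> Q %| map_poly phi P ->
  forall i, algebraicOver phi Q`_i.
Proof.
move=> P0; have [n] := ubnP (size Q).
elim: n K phi Q => // n IH K phi Q ltn monQ QP i.
have [/size1_polyC Qc|/root_in_extension [L [rho [x Qx]]]] := leqP (size Q) 1.
  move: monQ; rewrite Qc monicE lead_coefC => /eqP ->.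
  by rewrite coefC; case: ifP => _; [exact: algebraic1|exact: algebraic0].
apply/(algebraic_rmorph phi rho); rewrite -coef_map.
have QPrho : map_poly rho Q %| map_poly (rho \o phi) P.
  by rewrite map_poly_comp dvdp_map.
have algx : algebraicOver (rho \o phi) x.
  exists P => //; move: Qx; rewrite -!dvdp_XsubCl => /dvdp_trans; exact.
have /factor_theorem [R QE] := Qx.
have monR : R \is monic.
  by rewrite -(monicMr _ (monicXsubC x)) -QE map_monic.
have algR : forall j, algebraicOver (rho \o phi) R`_j.
  apply: IH => //; last by apply: dvdp_trans QPrho; rewrite QE dvdp_mulr.
  move: ltn; rewrite -(size_map_poly rho) QE size_Mmonic ?monicXsubC //.
    by rewrite size_XsubC addn2.
  exact: monic_neq0.
rewrite QE mulrBr coefB coefMX coefMC; apply: algebraic_sub.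
  by case: eqP => _; [exact: algebraic0|exact: algR].
exact: algebraic_mul.
Qed.

(** * Finite families contained in the span of their own [r]-th powers *)

Lemma linear_dependence (E : fieldType) (J : finType) n (A : 'I_n -> J -> E) :
  (#|J| < n)%N ->
  exists2 c : 'I_n -> E, exists k, c k != 0 & forall j, \sum_k c k * A k j = 0.
Proof.
move=> ltJn; pose B := \matrix_(k < n, j < #|J|) A k (enum_val j).
have : kermx B != 0.
  rewrite kermx_eq0 /row_free; apply: contraTneq (rank_leq_col B) => ->.
  by rewrite -ltnNge.
case/rowV0Pn => v /sub_kermxP vB0 v0; exists (v 0) => [|j].
  by case/rV0Pn: v0 => k vk; exists k.
move/rowP/(_ (enum_rank j)): vB0; rewrite !mxE => vB; rewrite -[RHS]vB.
by apply: eq_bigr => k _; rewrite mxE enum_rankK.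
Qed.

Lemma expr_sum_pchar (R : comNzRingType) (I : Type) (s : seq I) (A : pred I)
    (G : I -> R) r :
  ([pchar R].-nat r)%N ->
  (\sum_(i <- s | A i) G i) ^+ r = \sum_(i <- s | A i) G i ^+ r.
Proof.
move=> pr; apply: (big_morph (fun x => x ^+ r)) => [x y|].
  exact: exprDn_pchar.
by rewrite expr0n; case: r pr.
Qed.

Section FrobeniusSpan.
Context {E K : fieldType} (phi : {rmorphism E -> K}).
Variables (I : finType) (f : I -> K) (M : I -> I -> E) (r : nat).
Hypotheses (r_pchar : ([pchar K].-nat r)%N) (r_gt1 : (1 < r)%N).
Hypothesis fE : forall i, f i = \sum_j phi (M i j) * f j ^+ r.

(** Substituting [fE] raises the exponent by one more factor [r], because the power map is additive;
    this brings different powers to a common exponent. *)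
Lemma frobenius_span_power k d i :
  exists W : I -> E,
    f i ^+ (r ^ k) = \sum_j phi (W j) * f j ^+ (r ^ (k + d)).
Proof.
elim: d => [|d [W fW]].
  exists (fun j => (j == i)%:R); rewrite addn0 (bigD1 i) //= eqxx rmorph1 mul1r.
  by rewrite big1 ?addr0 // => j /negPf ->; rewrite rmorph0 mul0r.
exists (fun l => \sum_j W j * M j l ^+ (r ^ (k + d))); rewrite fW.
under [RHS]eq_bigr do rewrite rmorph_sum mulr_suml.
rewrite [RHS]exchange_big; apply: eq_bigr => j _ /=.
rewrite {1}fE expr_sum_pchar ?pnatX ?r_pchar // mulr_sumr.
apply: eq_bigr => l _.
by rewrite exprMn -exprM -expnS addnS rmorphM rmorphXn mulrA.
Qed.

(* The #|I| + 1 elements f i ^+ (r ^ k) all lie in the span of the #|I|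
   elements f j ^+ (r ^ #|I|). *)
Lemma frobenius_span_algebraic i : algebraicOver phi (f i).
Proof.
pose N := #|I|.
have /fin_all_exists [W fW] : forall k : 'I_N.+1, exists W : I -> E,
    f i ^+ (r ^ k) = \sum_j phi (W j) * f j ^+ (r ^ N).
  move=> k; have := frobenius_span_power k (N - k) i.
  by rewrite subnKC // -ltnS.
have [c [k ck] c0] := linear_dependence W (ltnSn N).
exists (\sum_k c k *: 'X^(r ^ k)).
  apply: contraNneq ck => /polyP /(_ (r ^ k)%N); rewrite coef0 coef_sum => <-.
  rewrite (bigD1 k) //= coefZ coefXn eqxx mulr1 big1 ?addr0 // => l lk.
  by rewrite coefZ coefXn eqn_exp2l // val_eqE eq_sym (negPf lk) mulr0.
rewrite rootE rmorph_sum horner_sum /=.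
under eq_bigr do rewrite map_polyZ map_polyXn hornerZ hornerXn fW mulr_sumr.
rewrite exchange_big big1 // => j _ /=.
by under eq_bigr do rewrite mulrA -rmorphM; rewrite -mulr_suml -rmorph_sum c0
   rmorph0 mul0r.
Qed.

End FrobeniusSpan.

(** * Valuations and Cartier operators *)

Section LaurentOrder.
Context {F : fieldType}.
Implicit Types (x y : laurent F) (a b n : int).

Lemma vanish_add a x y :
  vanish_below a x -> vanish_below a y -> vanish_below a (x + y).
Proof. by move=> xa ya n na; rewrite lcoefD xa ?ya ?addr0. Qed.

Lemma vanish_opp a x : vanish_below a x -> vanish_below a (- x).
Proof. by move=> xa n na; rewrite lcoefN xa ?oppr0. Qed.

Lemma vanish_sub a x y :
  vanish_below a x -> vanish_below a y -> vanish_below a (x - y).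
Proof. by move=> xa ya; apply: vanish_add => //; exact: vanish_opp. Qed.

Lemma vanish_scale a c x : vanish_below a x -> vanish_below a (c *: x).
Proof. by move=> xa n na; rewrite lcoefZ xa ?mulr0. Qed.

Lemma vanish_sum a (I : Type) (r : seq I) (A : pred I) (G : I -> laurent F) :
  (forall i, A i -> vanish_below a (G i)) ->
  vanish_below a (\sum_(i <- r | A i) G i).
Proof.
by move=> Ga n na; rewrite lcoef_sum big1 // => i Ai; rewrite (Ga i).
Qed.

Lemma vanish_mul a b x y :
  vanish_below a x -> vanish_below b y -> vanish_below (a + b) (x * y).
Proof. exact: conv_below. Qed.

Lemma vanish_exp a x k : vanish_below a x -> vanish_below (a * k%:Z) (x ^+ k).
Proof.
move=> xa; elim: k => [|k IH]; first by rewrite mulr0; exact: mono_vanish.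
by rewrite exprS (_ : _ * _ = a + a * k%:Z); [exact: vanish_mul|lia].
Qed.

Lemma vanish_eq0 x : (forall k : nat, vanish_below k%:Z x) -> x = 0.
Proof. by move=> x0; apply/laurentP => n; apply: (x0 `|n|.+1%N); lia. Qed.

Lemma vanish_polyzV (c : {poly F}) : vanish_below 0 (horner_alg lz^-1 c).
Proof.
move=> n n0; rewrite lzV horner_alg_lmono lcoef_sum big1 // => k _.
by rewrite lcoefZ /= (_ : _ == _ = false) ?mulr0 //; lia.
Qed.

Lemma lmono_mul i x n : (lmono i * x) n = x (n - i).
Proof. exact: conv_mono. Qed.

Lemma lmono_neq0 i : lmono i != 0 :> laurent F.
Proof. by apply/eqP => /laurentP /(_ i) /eqP; rewrite /= eqxx oner_eq0. Qed.

Lemma lmonoV i : (lmono i)^-1 = lmono (- i) :> laurent F.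
Proof.
by apply: (mulfI (lmono_neq0 i)); rewrite divff ?lmono_neq0 // lmonoM subrr.
Qed.

Lemma lcoef_mul_low a b x y : vanish_below a x -> vanish_below b y ->
  (x * y) (a + b) = x a * y b.
Proof.
move=> xa yb; have := convE 0 xa yb.
by rewrite big_ord1 subnn !addr0 => <-.
Qed.

Lemma lcoef_exp_low a x k : vanish_below a x ->
  (x ^+ k) (a * k%:Z) = x a ^+ k.
Proof.
move=> xa; elim: k => [|k IH]; first by rewrite mulr0 !expr0 lcoef1.
rewrite !exprS -IH -(lcoef_mul_low xa (vanish_exp (k := k) xa)).
by congr (_ : F); congr lcoef; lia.
Qed.

Lemma laurent_split a x K : vanish_below a x ->
  exists2 y : laurent F, vanish_below (a + K%:Z) y &
    x = \sum_(k < K) x (a + k%:Z) *: lmono (a + k%:Z) + y.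
Proof.
move=> xa; exists (x - \sum_(k < K) x (a + k%:Z) *: lmono (a + k%:Z)).
  2: by rewrite addrC subrK.
move=> n nK; rewrite lcoefB lcoef_sum; under eq_bigr do rewrite lcoefZ /=.
have [na|/int_split [k nE]] := ltP n a.
  rewrite xa // big1 ?subr0 // => k _.
  by rewrite (_ : _ == _ = false) ?mulr0 //; lia.
have kK : (k < K)%N by lia.
rewrite (bigD1 (Ordinal kK)) //= -nE eqxx mulr1 big1 ?addr0 ?subrr // => l.
rewrite -val_eqE /= => lk; rewrite (_ : _ == _ = false) ?mulr0 //.
by move/eqP: lk => lk; lia.
Qed.

Lemma lcoef_neq0 x n : x n != 0 -> x != 0.
Proof. by apply: contraNneq => ->; rewrite lcoef0. Qed.

(** The lowest coefficients of [x] and of its inverse multiply to a nonzero coefficient of [1], so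
    their positions add up to [0]. *)
Lemma valuation_inv (v : int) x : vanish_below v x -> x v != 0 ->
  let y : laurent F := x^-1 in vanish_below (- v) y /\ y (- v) != 0.
Proof.
move=> xv xv0 y; have x0 := lcoef_neq0 xv0.
have [w w0 xw] := laurent_valuation (invr_neq0 x0).
suff -> : - v = w by [].
have := lcoef_mul_low xv xw; rewrite mulfV // lcoef1 => vw.
have := mulf_neq0 xv0 w0; rewrite -vw; case: (_ =P 0 :> int) => [|_]; first lia.
by rewrite eqxx.
Qed.

End LaurentOrder.

Definition field_order (F : finFieldType) : nat := #|F|.

Lemma field_order_gt1 F : (1 < field_order F)%N.
Proof. exact: finNzRing_gt1. Qed.

Section Cartier.
Context {F : finFieldType}.
Implicit Types (x y w : laurent F) (n : int).
Local Notation q := (field_order F).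

Fact cartier_bounded j x :
  exists m : int, forall n : int, n < - m -> x (q%:Z * n + j%:Z) = 0.
Proof.
have q_gt1 := field_order_gt1 F.
have [a xa] := lcoef_vanish x; exists (`|a| + j%:Z) => n na; apply: xa; nia.
Qed.
(** The sections modulo [q]: with [t = 1/z], [x] is the sum over [j < q] of [t ^ j] times the [q]-th
    power of [cartier j x]. *)
Definition cartier j x := Laurent (cartier_bounded j x).

Lemma cartierE j x n : cartier j x n = x (q%:Z * n + j%:Z). Proof. by []. Qed.

Lemma cartierD j : {morph cartier j : x y / x + y}.
Proof. by move=> x y; apply/laurentP. Qed.

Lemma cartier0 j : cartier j 0 = 0.
Proof. by apply/laurentP. Qed.

Lemma cartier_sum j (I : Type) (r : seq I) (A : pred I) (G : I -> laurent F) :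
  cartier j (\sum_(i <- r | A i) G i) = \sum_(i <- r | A i) cartier j (G i).
Proof. exact: (big_morph _ (cartierD j) (cartier0 j)). Qed.

Definition cartier_poly j (c : {poly F}) : {poly F} :=
  \poly_(k < size c) c`_(q * k + j).

Lemma coef_cartier_poly j (c : {poly F}) k :
  (cartier_poly j c)`_k = c`_(q * k + j).
Proof.
have q_gt1 := field_order_gt1 F; rewrite coef_poly; case: ltnP => // ck.
rewrite nth_default // (leq_trans ck) // (leq_trans _ (leq_addr _ _)) //.
by rewrite leq_pmull // ltnW.
Qed.

(** This division of degrees by [q] keeps [bounded_span] stable. *)
Lemma size_cartier_poly j (c : {poly F}) B : (size c <= q * B)%N ->
  (size (cartier_poly j c) <= B)%N.
Proof.
move=> cB; apply/leq_sizeP => k Bk; rewrite coef_cartier_poly nth_default //.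
by rewrite (leq_trans cB) // (leq_trans _ (leq_addr _ _)) // leq_mul2l Bk orbT.
Qed.

Lemma cartier_polyzV j c : (j < q)%N ->
  cartier j (horner_alg lz^-1 c) = horner_alg lz^-1 (cartier_poly j c).
Proof.
move=> jq; apply/laurentP => n; rewrite cartierE.
have [n0|/int_split [k ->]] := ltP n 0.
  by rewrite !vanish_polyzV //; nia.
rewrite add0r lcoef_polyzV coef_cartier_poly -lcoef_polyzV; congr lcoef; lia.
Qed.

Lemma cartier_poly_neq0 c : c != 0 ->
  exists2 j, (j < q)%N & cartier_poly j c != 0.
Proof.
have q_gt1 := field_order_gt1 F; move=> c0; pose k := (size c).-1.
(* The residue of the degree selects the section containing the leading coefficient. *)
exists (k %% q)%N; first by rewrite ltn_mod; lia.
apply: contraNneq c0 => /polyP /(_ (k %/ q)%N).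
rewrite coef_cartier_poly mulnC -divn_eq coef0 => /eqP.
by rewrite -lead_coefE lead_coef_eq0.
Qed.

End Cartier.

Section Frobenius.
Context {F : finFieldType}.
Local Notation q := (field_order F).
Variables (p e : nat).
Hypotheses (p_prime : prime p) (card_F : q = (p ^ e)%N).
Implicit Types (x y w : laurent F) (n : int).

Lemma card_pchar (A : lalgType F) : ([pchar A].-nat q)%N.
Proof.
rewrite card_F pnatX pnatE // (pchar_lalg A).
by rewrite (card_finPcharP card_F p_prime).
Qed.

Lemma lcoef_frob_split a x K n : vanish_below a x -> n < (a + K%:Z) * q%:Z ->
  (x ^+ q) n = \sum_(k < K) x (a + k%:Z) * (n == (a + k%:Z) * q%:Z)%:R.
Proof.
move=> xa nK; have [y ya xE] := laurent_split K xa.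
rewrite {1}xE exprDn_pchar ?card_pchar // lcoefD (vanish_exp ya nK) addr0.
rewrite expr_sum_pchar ?card_pchar // lcoef_sum; apply: eq_bigr => k _.
by rewrite exprZn expf_card lmonoX lcoefZ.
Qed.

Lemma lcoef_frob x n : (x ^+ q) (q%:Z * n) = x n.
Proof.
have q_gt1 := field_order_gt1 F; have [a xa] := lcoef_vanish x.
have [na|/int_split [k ->]] := ltP n a.
  by rewrite xa // (vanish_exp xa) //; nia.
rewrite (lcoef_frob_split (K := k.+1) xa) ?[q%:Z * _]mulrC; last by nia.
rewrite big_ord_recr /= eqxx mulr1 big1 ?add0r // => j _.
have q0 : q%:Z != 0 by lia.
rewrite (inj_eq (mulIf q0)) (_ : _ == _ = false) ?mulr0 //.
have := ltn_ord j; lia.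
Qed.

Lemma lcoef_frob0 x m : (forall n, m != q%:Z * n) -> (x ^+ q) m = 0.
Proof.
move=> hm; have [a xa] := lcoef_vanish x.
have q_gt1 := field_order_gt1 F.
rewrite (lcoef_frob_split (K := (`|a| + `|m| + 1)%N) xa); last by nia.
by rewrite big1 // => k _; rewrite [_ * q%:Z]mulrC (negPf (hm _)) mulr0.
Qed.

Lemma cartier_frob j x w : cartier j (x ^+ q * w) = x * cartier j w.
Proof.
have q_gt1 := field_order_gt1 F.
apply/laurentP => n; rewrite cartierE !lcoefM.
(* A [q]-th power has coefficients only at multiples of [q], so the product is summed over those
   indices. *)
rewrite -(@fsbig_widen _ _ _ _ (range (fun i => q%:Z * i))) //; last first.
  move=> m [_ hm] /=; rewrite lcoef_frob0 ?mul0r // => i; apply/eqP => mi.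
  by apply: hm; exists i.
rewrite (reindex_fsbig (fun i => q%:Z * i) [set: int]%classic).
  apply: eq_fsbigr => i _; rewrite lcoef_frob cartierE; congr (_ * w _); lia.
split=> [i _|i k _ _ /mulfI|m [i _ <-]].
- by exists i.
- by apply; lia.
- by exists i.
Qed.

End Frobenius.

(** * Rational functions and Frobenius relations of algebraic series *)

Lemma modp_sum (K : fieldType) (P : {poly K}) (I : Type) (r : seq I)
    (A : pred I) (G : I -> {poly K}) :
  (\sum_(i <- r | A i) G i) %% P = \sum_(i <- r | A i) (G i %% P).
Proof. exact: (big_morph (fun R => R %% P) (modpD P) (mod0p P)). Qed.

Section RationalFunctions.
Context {F : fieldType}.
Implicit Types (x y : laurent F) (c : {poly F}).
Local Notation tofrac := (@FracField.tofrac {poly F}).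

Lemma rat_invz_tofrac c : rat_invz (tofrac c) = horner_alg lz^-1 c.
Proof.
rewrite -[tofrac c]divr1 -(rmorph1 tofrac) rat_invz_div ?oner_eq0 //.
by rewrite rmorph1 divr1.
Qed.

Lemma algebraic_polyzV c : algebraicOver (@rat_invz F) (horner_alg lz^-1 c).
Proof. rewrite -rat_invz_tofrac; exact: algebraic_id. Qed.

Lemma algebraic_scalar (k : F) : algebraicOver (@rat_invz F) k%:A.
Proof.
by rewrite -(horner_algC (lz^-1 : laurent F)); exact: algebraic_polyzV.
Qed.

Lemma algebraic_lzV : algebraicOver (@rat_invz F) lz^-1.
Proof. by rewrite -[lz^-1]horner_algX; exact: algebraic_polyzV. Qed.

Lemma common_denominator n (c : 'I_n -> {fraction {poly F}}) :
  exists2 d : {poly F}, d != 0 &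
    exists a : 'I_n -> {poly F}, forall k, tofrac d * c k = tofrac (a k).
Proof.
exists (\prod_k \d_(repr (c k))).
  by rewrite prodf_seq_neq0; apply/allP => k _; rewrite implyTb denom_ratioP.
exists (fun k => \n_(repr (c k)) * \prod_(l | l != k) \d_(repr (c l))) => k.
rewrite {1}[c k]fraction_repr (bigD1 k) //= !rmorphM.
by rewrite mulrC mulrA divfK ?tofrac_eq0 ?denom_ratioP.
Qed.

End RationalFunctions.

Section SeparableRelation.
Context {F : finFieldType}.
Local Notation q := (field_order F).
Variables (p e : nat).
Hypotheses (p_prime : prime p) (card_F : q = (p ^ e)%N).
Implicit Types (x y : laurent F).
Local Notation tofrac := (@FracField.tofrac {poly F}).

(** The [N + 1] residues of the ['X^(q ^ k)] modulo [P] lie in a space of dimension [N = deg P], so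
    a nontrivial combination of these powers is divisible by [P] and vanishes at [x]; denominators
    are then cleared. *)
Lemma frobenius_relation x : algebraicOver (@rat_invz F) x ->
  exists n (c : nat -> {poly F}), (exists2 k, (k < n)%N & c k != 0) /\
    \sum_(k < n) horner_alg lz^-1 (c k) * x ^+ (q ^ k) = 0.
Proof.
move=> [P P0 Px]; pose N := (size P).-1.
have PN : size P = N.+1 by rewrite prednK ?size_poly_gt0.
pose A (k : 'I_N.+1) (j : 'I_N) := ('X^(q ^ k) %% P)`_j.
have [c [k ck] cA] : exists2 c, exists k, c k != 0 &
    forall j, \sum_k c k * A k j = 0.
  by apply: linear_dependence; rewrite card_ord.
have [d d0 [a da]] := common_denominator c.
have c0 : \sum_k rat_invz (c k) * x ^+ (q ^ k) = 0.
  pose R := \sum_k c k *: 'X^(q ^ k).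
  have PR : P %| R.
    apply/modp_eq0P/polyP => j; rewrite modp_sum coef0 coef_sum.
    have [jN|Nj] := ltnP j N.
      rewrite -[RHS](cA (Ordinal jN)); apply: eq_bigr => l _.
      by rewrite modpZl coefZ.
    rewrite big1 // => l _; rewrite modpZl coefZ nth_default ?mulr0 //.
    rewrite (leq_trans _ Nj) // -ltnS.
    by have := ltn_modp 'X^(q ^ l) P; rewrite PN P0.
  have : root (map_poly rat_invz R) x.
    by move: Px; rewrite -!dvdp_XsubCl => /dvdp_trans; apply; rewrite dvdp_map.
  rewrite rootE rmorph_sum horner_sum /= => /eqP.
  by under eq_bigr do rewrite map_polyZ map_polyXn hornerZ hornerXn.
exists N.+1, (fun k => a (inord k)); split.
  exists (k : nat); first exact: ltn_ord.
  rewrite inord_val -(tofrac_eq0 (a k)) -da.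
  by apply: mulf_neq0 ck; rewrite tofrac_eq0.
rewrite -[RHS](mulr0 (rat_invz (tofrac d))) -[in RHS]c0 mulr_sumr.
apply: eq_bigr => l _.
by rewrite inord_val mulrA -rmorphM da /= rat_invz_tofrac.
Qed.

(* Applying a Cartier operator to a relation without constant term divides
   the exponents by q, and some operator keeps the relation nontrivial. *)
Lemma separable_relation x : algebraicOver (@rat_invz F) x ->
  exists n (c : nat -> {poly F}), c 0%N != 0 /\
    \sum_(k < n.+1) horner_alg lz^-1 (c k) * x ^+ (q ^ k) = 0.
Proof.
move=> /frobenius_relation [n [c [[k kn ck] rel]]].
elim: n k c kn ck rel => // n IH k c kn ck rel.
have [c0|c0] := eqVneq (c 0%N) 0; last by exists n, c.
case: k kn ck => [|k] kn ck; first by rewrite c0 eqxx in ck.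
have [j jq cjk] := cartier_poly_neq0 ck.
apply: (IH k (fun k => cartier_poly j (c k.+1))) => //.
rewrite -[RHS](cartier0 j) -[in RHS]rel big_ord_recl c0 rmorph0 mul0r add0r.
rewrite cartier_sum; apply: eq_bigr => l _.
rewrite -cartier_polyzV // [RHS]/(cartier _ _) mulrC.
rewrite -(cartier_frob p_prime card_F) mulrC -exprM.
by rewrite [(q ^ l * q)%N]mulnC -expnS mulrC.
Qed.

(* Here g = x / c_0 for a separable relation sum_i c_i x^(q^i) = 0, so that
   a_i = - c_(i+1) c_0^(q^(i+1) - 2) is a polynomial since q^(i+1) >= 2. *)
Lemma frobenius_equation x : algebraicOver (@rat_invz F) x ->
  exists (b : {poly F}) (g : laurent F) d (a : nat -> {poly F}),
    x = horner_alg lz^-1 b * g /\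
    g = \sum_(i < d) horner_alg lz^-1 (a i) * g ^+ (q ^ i.+1).
Proof.
move=> /separable_relation [n [c [c0 rel]]].
have q_gt1 := field_order_gt1 F.
pose b := horner_alg lz^-1 (c 0%N) : laurent F.
have b0 : b != 0 by rewrite polyzV_eq0.
exists (c 0%N), (x / b), n, (fun i => - c i.+1 * c 0%N ^+ (q ^ i.+1 - 2)).
split; first by rewrite mulrC divfK.
apply: (mulIf b0); rewrite divfK //; apply: (mulIf b0).
move: rel; rewrite big_ord_recl expn0 expr1 mulrC => /eqP.
rewrite addr_eq0 => /eqP ->; rewrite -sumrN !mulr_suml; apply: eq_bigr => i _.
rewrite rmorphM rmorphN rmorphXn -/b expr_div_n /=.
have qi : (2 <= q ^ i.+1)%N.
  by rewrite (leq_trans q_gt1) // expnS leq_pmulr // expn_gt0; lia.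
have -> : b ^+ (q ^ i.+1) = b ^+ (q ^ i.+1 - 2) * b ^+ 2.
  by rewrite -exprD subnK.
have B0 : b ^+ (q ^ i.+1 - 2) != 0 by rewrite expf_neq0.
set y := x ^+ _; set B := b ^+ _ in B0 *; set C := horner_alg _ _.

by field; rewrite b0 B0.
Qed.

End SeparableRelation.

(** * Automatic sequences and algebraic series *)

Section Automatic.
Variable p : nat.

(** The kernel reads a sequence at positive indices only. *)
Lemma automatic_eq (A : Type) (u v : nat -> A) :
  (forall n, u n.+1 = v n.+1) -> automatic p u -> automatic p v.
Proof.
move=> uv; apply: sub_finite_set => _ [i [j ji ->]]; exists i, j => //.
by apply/funext => n; rewrite !addn1 uv.
Qed.

Lemma automatic_map2 (A B C : Type) (h : A -> B -> C) u v :
  automatic p u -> automatic p v -> automatic p (fun n => h (u n) (v n)).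
Proof.
move=> fu fv.
apply: (sub_finite_set _ (finite_image2 (fun u v n => h (u n) (v n)) fu fv)).
move=> _ [i [j ji ->]] /=.
by exists (fun n => u (n * p ^ i + j + 1)%N); [exists i, j|
  exists (fun n => v (n * p ^ i + j + 1)%N); [exists i, j|]].
Qed.

Lemma automatic_const (A : Type) (a : A) : automatic p (fun=> a).
Proof.
apply: (sub_finite_set _ (finite_set1 (fun _ : nat => a))).
by move=> _ [i [j ji ->]].
Qed.

Lemma automatic_map (A B : Type) (h : A -> B) u :
  automatic p u -> automatic p (fun n => h (u n)).
Proof.
by move=> /(automatic_map2 (fun a _ => h a))/(_ (automatic_const tt)).
Qed.

Lemma automatic_sum (V : nmodType) n (u : 'I_n -> nat -> V) :
  (forall k, automatic p (u k)) -> automatic p (fun m => \sum_k u k m).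
Proof.
elim: n u => [|n IH] u au.
  by under eq_fun do rewrite big_ord0; exact: automatic_const.
under eq_fun do rewrite big_ord_recl.
exact: automatic_map2 (au _) (IH _ (fun k => au _)).
Qed.

End Automatic.

Section PowerSeries.
Context {F : fieldType}.

Fact lseries_bounded (u : nat -> F) : exists m : int, forall n : int, n < - m ->
  (if 0 <= n then u `|n|%N else 0) = 0.
Proof. by exists 0 => n n0; rewrite ifF //; lia. Qed.
Definition lseries u := Laurent (lseries_bounded u).

Lemma lseries_nat u (n : nat) : lseries u n%:Z = u n. Proof. by []. Qed.

Lemma lseries_vanish u : vanish_below 0 (lseries u).
Proof. by move=> n n0 /=; rewrite ifF //; lia. Qed.

End PowerSeries.

(** * Christol's theorem *)

Section Christol.
Context {F : finFieldType}.
Local Notation q := (field_order F).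
Variables (p e : nat).
Hypotheses (p_prime : prime p) (card_F : q = (p ^ e)%N).
Implicit Types (x y g : laurent F).

Section Span.
Variables (g : laurent F) (d B : nat).

Definition bounded_span : set (laurent F) :=
  [set v | exists2 w : 'I_d.+1 -> {poly F}, forall i, (size (w i) <= B)%N &
     v = \sum_i horner_alg lz^-1 (w i) * g ^+ (q ^ i)]%classic.

Lemma finite_bounded_span : finite_set bounded_span.
Proof.
pose f (w : {ffun 'I_d.+1 -> 'rV[F]_B}) : laurent F :=
  \sum_i horner_alg lz^-1 (rVpoly (w i)) * g ^+ (q ^ i).
have fin : finite_set (f @` [set: {ffun 'I_d.+1 -> 'rV[F]_B}])%classic.
  exact/finite_image/finite_finset.
apply: sub_finite_set fin => _ [w wB ->] /=.
exists [ffun i => poly_rV (w i)] => //; apply: eq_bigr => i _.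
by rewrite ffunE poly_rV_K.
Qed.

(** Replacing [g] through its equation leaves only [q]-th powers, out of which the Cartier operator
    takes a root. The new coefficients have size at most [2 * B] before degrees are divided by [q],
    and [q >= 2]. *)
Lemma cartier_bounded_span (a : nat -> {poly F}) j v :
  g = \sum_(i < d) horner_alg lz^-1 (a i) * g ^+ (q ^ i.+1) ->
  (forall i, (i < d)%N -> (size (a i) <= B)%N) -> (j < q)%N ->
  bounded_span v -> bounded_span (cartier j v).
Proof.
move=> gE aB jq [w wB ->].
(* The coefficient of [g ^+ (q ^ i.+1)]; no term reaches the last index [i = d] after the shift. *)
pose w' i := if (i < d)%N then w ord0 * a i + w (inord i.+1) else 0.
have wE : \sum_i horner_alg lz^-1 (w i) * g ^+ (q ^ i) =
    \sum_(i < d.+1) (g ^+ (q ^ i)) ^+ q * horner_alg lz^-1 (w' i).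
  rewrite big_ord_recl {1}expn0 expr1 {1}gE mulr_sumr -big_split /=.
  rewrite big_ord_recr /= /w' ltnn rmorph0 mulr0 addr0.
  apply: eq_bigr => i _; rewrite ltn_ord rmorphD rmorphM -exprM -expnSr.
  rewrite (_ : inord _ = lift ord0 i) /=; last first.
    by apply/val_inj; rewrite /= inordK // ltnS.
  by rewrite [RHS]mulrC mulrDl mulrA.
exists (fun i => cartier_poly j (w' i)).
  move=> i; apply: size_cartier_poly; rewrite /w'; case: ifP => id.
    apply: leq_trans (size_polyD _ _) _; rewrite geq_max; apply/andP; split.
      apply: leq_trans (size_polyMleq _ _) _.
      apply: (@leq_trans (2 * B)).
        2: by rewrite leq_mul2r field_order_gt1 orbT.
      have := wB ord0; have := aB _ id; lia.
    by apply: leq_trans (wB _) _; rewrite leq_pmull // ltnW // field_order_gt1.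
  by rewrite size_poly0.
rewrite wE cartier_sum; apply: eq_bigr => i _.
by rewrite (cartier_frob p_prime card_F) cartier_polyzV // mulrC.
Qed.

End Span.

Lemma algebraic_cartier_stable x : algebraicOver (@rat_invz F) x ->
  exists V : set (laurent F), [/\ finite_set V, V x &
    forall j v, (j < q)%N -> V v -> V (cartier j v)].
Proof.
move=> /(frobenius_equation p_prime card_F) [b [g [d [a [xE gE]]]]].
pose B := (size b + \sum_(i < d) size (a i))%N.
have aB i : (i < d)%N -> (size (a i) <= B)%N.
  by move=> id; rewrite /B (bigD1 (Ordinal id)) //=; lia.
exists (bounded_span g d B); split; first exact: finite_bounded_span.
  exists (fun i => if i == ord0 then b else 0).
    by move=> i; case: eqP => _; rewrite ?size_poly0 // leq_addr.
  rewrite big_ord_recl eqxx expn0 expr1 big1 ?addr0 // => i _.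
  by rewrite rmorph0 mul0r.
by move=> j v; exact: cartier_bounded_span gE aB.
Qed.

Lemma automatic_of_algebraic x :
  algebraicOver (@rat_invz F) x -> automatic p (fun n : nat => x n%:Z).
Proof.
(* The kernel reads indices shifted by one; multiplying by [z] moves the coefficient at [n + 1] to
   [n]. *)
move=> algx; have algy : algebraicOver (@rat_invz F) (lz * x).
  apply: algebraic_mul algx; rewrite -[lz]invrK.
  by apply: algebraic_inv; exact: algebraic_lzV.
have [V [finV Vy stV]] := algebraic_cartier_stable algy.
have q_gt1 := field_order_gt1 F.
(* Decimation by [q ^ i] iterates Cartier operators along the base-[q] digits of [j], so it stays in
   [V]. *)
have decimate i j : (j < q ^ i)%N ->
    exists2 v, V v & forall n, v n = (lz * x) (n * (q ^ i)%:Z + j%:Z).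
  elim: i j => [|i IH] j ji.
    exists (lz * x) => // n; congr lcoef; move: ji; rewrite expn0; lia.
  have qi : (0 < q ^ i)%N by rewrite expn_gt0; lia.
  have [v Vv vE] := IH (j %% q ^ i)%N (ltn_pmod j qi).
  have jq : (j %/ q ^ i < q)%N by rewrite ltn_divLR // -expnS.
  exists (cartier (j %/ q ^ i) v); first exact: stV.
  move=> n; rewrite cartierE vE; congr lcoef.
  rewrite {3}(divn_eq j (q ^ i)) expnS; lia.
(* Writing [i = r + e * k] with [r < e] gives [p ^ i = p ^ r * q ^ k]: decimation by [q ^ k] lands
   in [V], and [rj] records [r] and the remaining offset, which is below [p ^ r <= q]. *)
pose f (v : laurent F) (rj : 'I_e * 'I_q) (n : nat) : F :=
  v (n * p ^ rj.1 + rj.2)%N.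
have fin := finite_image2 f finV (@finite_finset _ [set: 'I_e * 'I_q]%classic).
apply: sub_finite_set fin => _ [i [j ji ->]] /=.
have e0 : (0 < e)%N by move: q_gt1; rewrite card_F; case: (e).
have iE : (p ^ i = p ^ (i %% e) * q ^ (i %/ e))%N.
  by rewrite card_F -expnM -expnD mulnC addnC -divn_eq.
have pr := ltn_pmod i e0.
have Q0 : (0 < q ^ (i %/ e))%N by rewrite expn_gt0; lia.
have jq : (j %/ q ^ (i %/ e) < q)%N.
  rewrite ltn_divLR //; apply: leq_trans ji _; rewrite iE leq_mul2r.
  by rewrite card_F leq_exp2l ?prime_gt1 // ltnW ?orbT.
have [v Vv vE] := decimate _ _ (ltn_pmod j Q0).
exists v => //; exists (Ordinal pr, Ordinal jq) => //.
apply/funext => n; rewrite /f /= vE lmono_mul; congr lcoef.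
rewrite iE {3}(divn_eq j (q ^ (i %/ e))); lia.
Qed.

Lemma lseries_decimate (u : nat -> F) :
  lseries u = \sum_(j < q) lz^-1 ^+ j * lseries (fun n => u (q * n + j)%N) ^+ q.
Proof.
have q_gt1 := field_order_gt1 F.
apply/laurentP => n; rewrite lcoef_sum lzV.
under eq_bigr do rewrite lmonoX mul1r lmono_mul.
have [n0|/int_split [m ->]] := ltP n 0.
  rewrite lseries_vanish // big1 // => j _.
  by rewrite (vanish_exp (lseries_vanish _)) //; lia.
have jq : (m %% q < q)%N by rewrite ltn_mod; lia.
rewrite add0r lseries_nat (bigD1 (Ordinal jq)) //= big1 ?addr0.
  rewrite (_ : _ - _ = q%:Z * (m %/ q)%N%:Z); last first.
    by rewrite {1}(divn_eq m q); lia.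
  by rewrite (lcoef_frob p_prime card_F) lseries_nat mulnC -divn_eq.
move=> j; rewrite -val_eqE /= => jm.
apply: (lcoef_frob0 p_prime card_F) => i; apply: contraNneq jm => mj.
have i0 : 0 <= i.
  rewrite leNgt; apply/negP => i0.
  have : q%:Z * i <= - q%:Z by nia.
  
  by have := ltn_ord j; lia.
have -> : m = (`|i| * q + j)%N by nia.
by rewrite modnMDl modn_small.
Qed.

(** The kernel is a finite family closed under decimation by [q], so [lseries_decimate] writes each
    of its series as a combination of [q]-th powers of series of the family over [F[1/z]]. *)
Lemma algebraic_of_automatic (u : nat -> F) : automatic p u ->
  algebraicOver (@rat_invz F) (lseries (fun n => u n.+1)).
Proof.
move=> /finite_seqP [s sE].
have us : (fun n => u n.+1) \in s.
  have : pkernel p u (fun n => u n.+1).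
    exists 0%N, 0%N => //; apply/funext => n; congr u; lia.
  by rewrite sE.
have dec v j : v \in s -> (j < q)%N -> (fun n => v (q * n + j)%N) \in s.
  move=> vs jq; have : pkernel p u v by rewrite sE.
  case=> i [k ki vE]; have : pkernel p u (fun n => v (q * n + j)%N).
    exists (e + i)%N, (j * p ^ i + k)%N.
      rewrite expnD -card_F; apply: (@leq_trans (j.+1 * p ^ i)); first lia.
      by rewrite leq_mul2r jq orbT.
    apply/funext => n; rewrite vE; congr u; rewrite expnD -card_F; lia.
  by rewrite sE.
pose I := 'I_(size s); pose v (i : I) := nth (fun=> 0) s i.
pose f i := lseries (v i).
have vs i : v i \in s by exact: mem_nth.
have vI w : w \in s -> exists i, v i = w.
  move=> ws; have lt : (index w s < size s)%N by rewrite index_mem.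
  by exists (Ordinal lt); rewrite /v nth_index.
have /choice [h hE] : forall ij : I * 'I_q, exists k,
    v k = fun n => v ij.1 (q * n + ij.2)%N.
  by move=> ij; apply/vI/dec.
(* Several residues [j] may lead to the same kernel element; their powers of [1/z] are added up. *)
pose M (i k : I) : {fraction {poly F}} :=
  \sum_(j < q | h (i, j) == k) FracField.tofrac 'X ^+ j.
have [i0 vi0] := vI _ us; rewrite -vi0 -[lseries _]/(f i0).
apply: (frobenius_span_algebraic (phi := @rat_invz F) (M := M) (r := q)).
- exact: (card_pchar p_prime card_F).
- exact: field_order_gt1.
move=> k {i0 vi0}; rewrite /f lseries_decimate.
under [RHS]eq_bigr do rewrite rmorph_sum mulr_suml.
rewrite (partition_big (fun j => h (k, j)) predT) //=.
apply: eq_bigr => l _; apply: eq_bigr => j /eqP hj.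
by rewrite rmorphXn /= rat_invz_tofrac horner_algX -hj hE.
Qed.

End Christol.

(** * Substitution of a series of positive valuation *)

Section Substitution.
Context {F : fieldType}.
Variables (s : laurent F) (m : nat).
Hypothesis m_gt0 : (0 < m)%N.
Hypotheses (s_low : vanish_below m%:Z s) (s_neq0 : s m%:Z != 0).
Implicit Types (x y : laurent F) (a b n : int) (c : {poly F}).

Lemma exprz_low n : vanish_below (m%:Z * n) (s ^ n) /\ (s ^ n) (m%:Z * n) != 0.
Proof.
have pos (k : nat) : vanish_below (m%:Z * k%:Z) (s ^+ k) /\
    (s ^+ k) (m%:Z * k%:Z) != 0.
  by rewrite lcoef_exp_low // expf_neq0 //; split=> //; exact: vanish_exp.
case: n => k; first exact: pos.
have [sk sk0] := pos k.+1; rewrite NegzE mulrN -exprnN.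
exact: valuation_inv sk sk0.
Qed.

Lemma horner_alg_wide c k : (size c <= k)%N ->
  horner_alg s c = \sum_(i < k) c`_i *: s ^+ i.
Proof.
move=> ck; rewrite /horner_alg /horner_morph.
rewrite (horner_coef_wide _ (n := k)) ?size_map_poly //.
by apply: eq_bigr => i _; rewrite coef_map mulr_algl.
Qed.

Lemma vanish_horner_alg c : vanish_below 0 (horner_alg s c).
Proof.
rewrite (horner_alg_wide (leqnn _)); apply: vanish_sum => i _.
apply: vanish_scale.
by apply: vanish_le (vanish_exp (k := i) s_low); nia.
Qed.

(** The coefficient of the composite [x(s)]: as [s] has valuation [m > 0], only finitely many [i]
    with [x i] nonzero contribute. *)
Definition subst_coef x n : F :=
  \sum_(i \in [set: int]%classic) x i * (s ^ i) n.

Lemma subst_coefE a x K n : vanish_below a x -> n < m%:Z * (a + K%:Z) ->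
  subst_coef x n = (s ^ a * horner_alg s (trunc K a x)) n.
Proof.
move=> xa nK; rewrite (horner_alg_wide (size_poly _ _)) mulr_sumr lcoef_sum.
rewrite /subst_coef (fsbigE [seq a + j%:Z | j <- iota 0 K]) //.
- rewrite big_mkcond big_map -{1}[K]subn0 -/(index_iota 0 K) big_mkord.
  apply: eq_bigr => k _; rewrite in_setT coef_poly ltn_ord -scalerAr lcoefZ.
  by rewrite exprnP -expfzDr ?(lcoef_neq0 s_neq0).
- by rewrite map_inj_uniq ?iota_uniq // => i j /addrI [].
move=> i _ /negP hi.
have [ia|/int_split [k iE]] := ltP i a; first by rewrite xa // mul0r.
have kK : (K <= k)%N.
  rewrite leqNgt; apply/negP => kK; apply: hi; apply/mapP; exists k => //.
  by rewrite mem_iota.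
by rewrite (exprz_low _).1 ?mulr0 //; nia.
Qed.

Fact subst_bounded x :
  exists N : int, forall n : int, n < - N -> subst_coef x n = 0.
Proof.
have [a xa] := lcoef_vanish x; exists (- (m%:Z * a)) => n; rewrite opprK => na.
rewrite (subst_coefE (K := 0) xa) ?addr0 // (_ : trunc _ _ _ = 0).
  by rewrite rmorph0 mulr0.
by apply/polyP => i; rewrite coef_poly coef0.
Qed.
Definition subst_fun x := Laurent (subst_bounded x).

Lemma vanish_subst a x :
  vanish_below a x -> vanish_below (m%:Z * a) (subst_fun x).
Proof.
move=> xa n na; rewrite [LHS](subst_coefE (K := 0) xa) ?addr0 //.
rewrite (_ : trunc _ _ _ = 0); first by rewrite rmorph0 mulr0.
by apply/polyP => i; rewrite coef_poly coef0.
Qed.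

Lemma subst_trunc a x K : vanish_below a x ->
  vanish_below (m%:Z * (a + K%:Z))
    (subst_fun x - s ^ a * horner_alg s (trunc K a x)).
Proof.
by move=> xa n nK; rewrite lcoefB [subst_fun x n](subst_coefE xa nK) subrr.
Qed.

Lemma subst_mono i : subst_fun (lmono i) = s ^ i.
Proof.
apply/laurentP => n; rewrite /= /subst_coef (fsbigE [:: i]) //.
  by rewrite big_mkcond big_seq1 in_setT /= eqxx mul1r.
by move=> j _; rewrite inE /= => /negPf ->; rewrite mul0r.
Qed.

Lemma subst_scale k x : subst_fun (k *: x) = k *: subst_fun x.
Proof.
apply/laurentP => n; rewrite lcoefZ /= /subst_coef mulr_fsumr.
by apply: eq_fsbigr => i _; rewrite mulrA.
Qed.

Fact subst_zmod_morphism : zmod_morphism subst_fun.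
Proof.
move=> x y; have [a [xa ya]] := vanish2 x y; apply/laurentP => n.
have [K nK] : exists K : nat, n < m%:Z * (a + K%:Z).
  by exists (`|n| + `|a| + 1)%N; nia.
rewrite lcoefB /= (subst_coefE xa nK) (subst_coefE ya nK).
rewrite (subst_coefE (vanish_sub xa ya) nK) -lcoefB -mulrBr -rmorphB.
congr ((_ * horner_alg s _) n); apply/polyP => i.
by rewrite coefB !coef_poly; case: ifP => _; rewrite ?subr0 ?lcoefB.
Qed.

(** Truncations multiply as polynomials up to high powers of the variable, so both sides agree to
    every order. *)
Fact subst_mul x y : subst_fun (x * y) = subst_fun x * subst_fun y.
Proof.
have [a xa] := lcoef_vanish x; have [b yb] := lcoef_vanish y.
apply/eqP; rewrite -subr_eq0; apply/eqP/vanish_eq0 => k.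
pose K := (k + `|a| + `|b|)%N.
have kK : k%:Z <= m%:Z * (a + b + K%:Z) by rewrite /K; nia.
have xya : vanish_below (a + b) (x * y) by exact: vanish_mul.
pose P := trunc K a x; pose Q := trunc K b y; pose R := drop_poly K (P * Q).
have PQ : P * Q = trunc K (a + b) (x * y) + R * 'X^K.
  rewrite -[LHS](poly_take_drop K); congr (_ + _); apply/polyP => i.
  rewrite coef_take_poly coef_poly; case: ifP => // iK.
  by rewrite -(conv_trunc xa yb iK).
pose rx := subst_fun x - s ^ a * horner_alg s P.
pose ry := subst_fun y - s ^ b * horner_alg s Q.
pose rxy :=
  subst_fun (x * y) - s ^ (a + b) * horner_alg s (trunc K (a + b) (x * y)).
(* Four errors: the tail of the product, the overflow [R], and the tails of [y] and [x]; each
   vanishes below [m * (a + b + K)]. *)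
have -> : subst_fun (x * y) - subst_fun x * subst_fun y =
    rxy - s ^ (a + b) * (horner_alg s R * s ^+ K)
    - (s ^ a * horner_alg s P) * ry - rx * subst_fun y.
  have := congr1 (horner_alg s) PQ.
  rewrite rmorphM rmorphD rmorphM rmorphXn /= horner_algX => E.
  rewrite /rxy /rx /ry expfzDr ?(lcoef_neq0 s_neq0) //.
  have -> : horner_alg s (trunc K (a + b) (x * y)) =
      horner_alg s P * horner_alg s Q - horner_alg s R * s ^+ K.
    by rewrite E addrK.
  by ring.
apply: (vanish_le kK); do 3?apply: vanish_sub.
- exact: subst_trunc.
- rewrite (_ : _ * _ = m%:Z * (a + b) + (0 + m%:Z * K%:Z)); last by lia.
  apply: vanish_mul; first exact: (exprz_low _).1.
  by apply: vanish_mul; [exact: vanish_horner_alg|exact: vanish_exp].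
- rewrite (_ : _ * _ = (m%:Z * a + 0) + m%:Z * (b + K%:Z)); last by lia.
  apply: vanish_mul; last exact: subst_trunc.
  by apply: vanish_mul; [exact: (exprz_low _).1|exact: vanish_horner_alg].
rewrite (_ : _ * _ = m%:Z * (a + K%:Z) + m%:Z * b); last by lia.
by apply: vanish_mul; [exact: subst_trunc|exact: vanish_subst].
Qed.

Fact subst_monoid_morphism : monoid_morphism subst_fun.
Proof. by split; [rewrite (subst_mono 0)|exact: subst_mul]. Qed.

Lemma substitution_morphism : exists psi : {rmorphism laurent F -> laurent F},
  [/\ psi lz^-1 = s, forall k : F, psi k%:A = k%:A &
      forall a x, vanish_below a x -> vanish_below (m%:Z * a) (psi x)].
Proof.
pose zM := GRing.isZmodMorphism.Build _ _ subst_fun subst_zmod_morphism.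
pose mM := GRing.isMonoidMorphism.Build _ _ subst_fun subst_monoid_morphism.
pose psi : {rmorphism laurent F -> laurent F} := HB.pack subst_fun zM mM.
exists psi; split; last exact: vanish_subst.
  by rewrite lzV; exact: (subst_mono 1).
by move=> k; rewrite -[LHS]/(subst_fun _) subst_scale (subst_mono 0).
Qed.

End Substitution.

(** * Coordinates over the series in 1/beta *)

Section Exchange.
Context {F K Q : fieldType} (iota : {rmorphism F -> K}).
Variables (frac : {rmorphism {poly F} -> Q}).
Hypothesis frac_inj : injective frac.
Hypothesis frac_denominator : forall n (c : 'I_n -> Q),
  exists2 d : {poly F}, d != 0 &
    exists a : 'I_n -> {poly F}, forall k, frac d * c k = frac (a k).
Variables (phi psi : {rmorphism Q -> K}) (u v : K).
Hypothesis phiE : forall c, phi (frac c) = (map_poly iota c).[u].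
Hypothesis psiE : forall c, psi (frac c) = (map_poly iota c).[v].

(* Both sides say that some nonzero bivariate polynomial vanishes at (u, v). *)
Lemma algebraic_exchange : algebraicOver phi v -> algebraicOver psi u.
Proof.
move=> [P P0 Pv].
have [d d0 [a da]] := frac_denominator (fun i : 'I_(size P) => P`_i).
pose R := \poly_(i < size P) (if insub i is Some k then a k else 0).
have RE : map_poly frac R = frac d *: P.
  apply/polyP => i; rewrite coef_map coefZ coef_poly; case: ltnP => [ip|pi].
    by rewrite insubT /= -da.
  by rewrite [in RHS]nth_default // mulr0 raddf0.
have eval2 (f : {rmorphism Q -> K}) x y
    (fE : forall c, f (frac c) = (map_poly iota c).[x]) (S : {poly {poly F}}) :
    (map_poly f (map_poly frac S)).[y] =
    (map_poly (map_poly iota) S).[y%:P].[x].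
  have hornerXY (U : {poly {poly K}}) :
      U.[y%:P].[x] = (map_poly (horner_eval x) U).[y].
    by rewrite -{2}(hornerC y x) -[y%:P.[x]]/(horner_eval x y%:P) horner_map.
  rewrite hornerXY -!map_poly_comp; congr (_.[_]).
  by apply: eq_map_poly => c /=; exact: fE.
have map_eq0 (S : {poly {poly F}}) : (map_poly frac S == 0) = (S == 0).
  by rewrite -(inj_eq (map_inj_poly frac_inj _)) ?raddf0.
exists (map_poly frac (swapXY R)).
  rewrite map_eq0 swapXY_eq0 -map_eq0 RE scale_poly_eq0 negb_or P0 andbT.
  by rewrite -(inj_eq frac_inj) raddf0 in d0 *.
rewrite rootE (eval2 psi v u psiE) -swapXY_map horner2_swapXY.
by rewrite -(eval2 phi u v phiE) RE map_polyZ hornerZ (rootP Pv) mulr0.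
Qed.

End Exchange.

(** * Digit series *)

Section DigitSeries.
Context {F : fieldType}.
Variable beta : laurent F.
Implicit Types (x : laurent F) (k n : nat).

Lemma vanish_iter_beta_map x n :
  vanish_below 0 x -> vanish_below 0 (iter n (beta_map beta) x).
Proof.
by case: n => // n _ k k0; rewrite iterS beta_map_coef ifT // ltW.
Qed.

(* The coefficients of z^k in the digits, as a power series in 1/z; the
   substitution 1/z |-> 1/beta turns it into the part of x carried by z^k. *)
Definition digit_series x k : laurent F :=
  lz^-1 * lseries (fun n => (beta_expansion beta x n.+1)`_k).

Lemma digit_seriesE x k n :
  digit_series x k n.+1%:Z = (beta_expansion beta x n.+1)`_k.
Proof.
by rewrite /digit_series lzV lmono_mul intS addrC addKr lseries_nat.
Qed.

End DigitSeries.

(** * Coordinates over the image of [psi], obtained from digits *)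

Section Expansion.
Context {F : fieldType}.
Variables (s : laurent F) (m : nat) (psi : {rmorphism laurent F -> laurent F}).
Hypothesis m_gt0 : (0 < m)%N.
Hypotheses (s_low : vanish_below m%:Z s) (s_neq0 : s m%:Z != 0).
Hypotheses (psiT : psi lz^-1 = s) (psiC : forall k : F, psi k%:A = k%:A).
Hypothesis psi_vanish : forall a (x : laurent F),
  vanish_below a x -> vanish_below (m%:Z * a) (psi x).
Implicit Types (x y : laurent F) (P : {poly laurent F}).

Lemma psi_scale (k : F) x : psi (k *: x) = k *: psi x.
Proof. by rewrite -mulr_algl rmorphM /= psiC mulr_algl. Qed.

Lemma psi_horner_alg (c : {poly F}) : psi (horner_alg lz^-1 c) = horner_alg s c.
Proof.
elim/poly_ind: c => [|c k IH]; first by rewrite !rmorph0.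
by rewrite !rmorphD !rmorphM /= !horner_algX !horner_algC psiC psiT IH.
Qed.

Lemma psi_mono n : psi (lmono n) = s ^ n.
Proof.
have pos (k : nat) : psi (lmono k%:Z) = s ^+ k.
  by rewrite -psiT -rmorphXn /= lzV lmonoX mul1r.
case: n => k; first exact: pos.
by rewrite NegzE -exprnN -pos -fmorphV lmonoV.
Qed.

Lemma psi_low a x :
  vanish_below a x -> psi x (m%:Z * a) = x a * (s ^ a) (m%:Z * a).
Proof.
move=> xa; have [y ya xE] := laurent_split 1 xa.
rewrite {1}xE big_ord1 addr0 rmorphD lcoefD psi_scale psi_mono lcoefZ.
by rewrite (psi_vanish ya) ?addr0 //; nia.
Qed.

Definition psi_eval P : laurent F := (map_poly psi P).[lz^-1].

Lemma psi_evalE P n : (size P <= n)%N ->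
  psi_eval P = \sum_(k < n) psi P`_k * lz^-1 ^+ k.
Proof.
move=> Pn; rewrite /psi_eval (horner_coef_wide _ (n := n)) ?size_map_poly //.
by apply: eq_bigr => k _; rewrite coef_map.
Qed.

(** The nonzero terms have valuations [k + m * v k], pairwise distinct modulo [m]; the least one
    cannot cancel. *)
Lemma psi_eval_inj P : (size P <= m)%N -> psi_eval P = 0 -> P = 0.
Proof.
move=> Pm; rewrite (psi_evalE Pm) => P0; apply/eqP.
case: (eqVneq P 0) => // Pneq0.
have /choice [v vP] : forall k : 'I_m, exists v : int,
    P`_k != 0 -> P`_k v != 0 /\ vanish_below v P`_k.
  move=> k; have [->|/laurent_valuation [v v0 vP]] := eqVneq P`_k 0.
    by exists 0.
  by exists v.
have lt0 : ((size P).-1 < m)%N by rewrite prednK ?size_poly_gt0.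
pose k0 := Ordinal lt0; have k0P : P`_k0 != 0.
  by rewrite -[P`_k0]/(lead_coef P) lead_coef_eq0.
pose idx (k : 'I_m) := k%:Z + m%:Z * v k.
case: (@arg_minP _ _ _ k0 (fun k : 'I_m => P`_k != 0) idx k0P) => k kP kmin.
have [vk0 vk] := vP k kP.
move/laurentP/(_ (idx k)): P0; rewrite lcoef_sum lcoef0.
under eq_bigr do rewrite mulrC lzV lmonoX mul1r lmono_mul.
rewrite (bigD1 k) //= big1 ?addr0 => [|l lk].
  rewrite /idx addrC addKr psi_low // => /eqP; rewrite mulf_eq0 (negPf vk0).
  by rewrite (negPf (exprz_low s_low s_neq0 _).2).
have [->|lP] := eqVneq P`_l 0; first by rewrite rmorph0.
have [vl0 vl] := vP l lP; apply: (psi_vanish vl).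
have := kmin l lP; rewrite /idx le_eqVlt => /orP [/eqP E|]; last by lia.
have lm := ltn_ord l; have km := ltn_ord k.
move: lk; rewrite -val_eqE /= => /eqP lk.
have vkl : v k = v l by nia.
by move: E; rewrite vkl; lia.
Qed.

Lemma psi_eval_scale x P : psi_eval (x *: P) = psi x * psi_eval P.
Proof. by rewrite /psi_eval map_polyZ hornerZ. Qed.

Lemma psi_lseries (u : nat -> F) N :
  exists2 y : laurent F, vanish_below (m%:Z * N%:Z) y &
    psi (lseries u) = \sum_(n < N) u n *: s ^+ n + y.
Proof.
have [y yN uE] := laurent_split N (lseries_vanish u).
exists (psi y); first by apply: psi_vanish; rewrite add0r in yN.
rewrite {1}uE rmorphD rmorph_sum; congr (_ + _); apply: eq_bigr => n _.
by rewrite add0r psi_scale psi_mono.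
Qed.

Local Notation beta := (s^-1).

Lemma beta_low : vanish_below (- m%:Z) beta.
Proof. by have [] := valuation_inv s_low s_neq0. Qed.

(** Since [beta] has degree [m], digits have degree at most [m] ([i = 0]), and less than [m] when
    taken from a series without constant term ([i = 1]). *)
Lemma size_digit (i : nat) x : vanish_below i%:Z x ->
  (size (ipart (beta * x)%R) <= m.+1 - i)%N.
Proof.
move=> xi; apply/leq_sizeP => k mk; rewrite coef_ipart.
by apply: (vanish_mul beta_low xi); lia.
Qed.

Lemma beta_expansion_partial x N :
  x = \sum_(n < N) horner_alg lz (beta_expansion beta x n.+1) * s ^+ n.+1
      + s ^+ N * iter N (beta_map beta) x.
Proof.
elim: N => [|N IH]; first by rewrite big_ord0 expr0 mul1r add0r.
rewrite big_ord_recr /= -addrA [LHS]IH; congr (_ + _).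
rewrite /beta_map /beta_expansion /= -/(beta_map _).
set y := iter N _ x; set a := horner_alg lz _.
by rewrite exprSr; field; exact: lcoef_neq0 s_neq0.
Qed.

(** Exchanging the sums over digits and over powers of [z] in a partial expansion gives partial sums
    of the substituted digit series, with errors of valuation at least [m * N]. *)
Lemma beta_expansion_series x : vanish_below 0 x ->
  x = \sum_(k < m.+1) lz ^+ k * psi (digit_series beta x k).
Proof.
move=> x0; apply/eqP; rewrite -subr_eq0; apply/eqP/vanish_eq0 => N.
have /choice [r rP] : forall k, exists y : laurent F,
    vanish_below (m%:Z * N%:Z) y /\
    psi (lseries (fun n => (beta_expansion beta x n.+1)`_k)) =
    \sum_(n < N) (beta_expansion beta x n.+1)`_k *: s ^+ n + y.
  move=> k; pose u n := (beta_expansion beta x n.+1)`_k.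
  by have [y yN yE] := psi_lseries u N; exists y.
have -> : \sum_(k < m.+1) lz ^+ k * psi (digit_series beta x k) =
    \sum_(n < N) horner_alg lz (beta_expansion beta x n.+1) * s ^+ n.+1 +
    \sum_(k < m.+1) lz ^+ k * (s * r k).
  under eq_bigr do rewrite /digit_series rmorphM psiT (rP _).2 2!mulrDr.
  rewrite big_split /=; congr (_ + _).
  under eq_bigr do rewrite !mulr_sumr.
  rewrite exchange_big; apply: eq_bigr => n _ /=.
  have sz : (size (beta_expansion beta x n.+1) <= m.+1)%N.
    have := size_digit (i := 0) (vanish_iter_beta_map beta n x0).
    by rewrite subn0.
  rewrite (horner_alg_wide _ sz) mulr_suml; apply: eq_bigr => k _.
  by rewrite -!scalerAl -!scalerAr exprS.
rewrite {1}(beta_expansion_partial x N) opprD addrACA subrr add0r.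
apply: vanish_sub.
  apply: (@vanish_le _ _ (m%:Z * N%:Z + 0)); first nia.
  by apply: vanish_mul; [exact: vanish_exp|exact: vanish_iter_beta_map].
apply: vanish_sum => k _.
apply: (@vanish_le _ _ (- k%:Z + (m%:Z + m%:Z * N%:Z))).
  by have := ltn_ord k; nia.
apply: vanish_mul; last by apply: vanish_mul => //; exact: (rP k).1.
by rewrite lmonoX mulN1r; exact: mono_vanish.
Qed.

(** The order is reversed because multiplication by [t ^ (m - 1)], with [t = 1/z], turns [z ^ k]
    into [t ^ (m - 1 - k)]; this covers [k < m] only. *)
Definition digit_poly x : {poly laurent F} :=
  \poly_(j < m) digit_series beta x (m.-1 - j).

Lemma psi_eval_digit_poly x : vanish_below 0 x ->
  psi_eval (digit_poly x) =
  lz^-1 ^+ m.-1 * (x - lz ^+ m * psi (digit_series beta x m)).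
Proof.
move=> x0; rewrite {2}(beta_expansion_series x0) big_ord_recr /= addrK.
rewrite (psi_evalE (size_poly _ _)) (reindex_inj rev_ord_inj) mulr_sumr /=.
apply: eq_bigr => k _; rewrite coef_poly ltn_subrL m_gt0.
have km := ltn_ord k; rewrite (_ : m.-1 - (m - k.+1) = k)%N; last by lia.
rewrite mulrA mulrC; congr (_ * _); rewrite exprVn.
rewrite (_ : m.-1 = m - k.+1 + k)%N; last by lia.
by rewrite exprVn exprD invfM -mulrA mulVf ?mulr1 // expf_neq0 // lz_neq0.
Qed.

(** Once [x] is scaled to valuation at least [1], all digits have degree less than [m], and the
    digit series provide the coordinates. *)
Lemma psi_eval_surj x :
  exists2 P : {poly laurent F}, (size P <= m)%N & psi_eval P = x.
Proof.
(* Chosen so that [- (m - 1) + m * N + a >= 1]. *)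
have [a xa] := lcoef_vanish x; pose N := (`|a| + m)%N.
pose y := lz ^+ m.-1 * (s ^+ N * x).
have y1 : vanish_below 1 y.
  apply: (@vanish_le _ _ (- m.-1%:Z + (m%:Z * N%:Z + a))).
    by rewrite /N; nia.
  apply: vanish_mul; first by rewrite lmonoX mulN1r; exact: mono_vanish.
  by apply: vanish_mul => //; exact: vanish_exp.
have y0 : vanish_below 0 y by exact: vanish_le y1.
have ym : digit_series beta y m = 0.
  rewrite /digit_series (_ : lseries _ = 0) ?mulr0 //; apply/laurentP => n /=.
  case: ifP => // _; rewrite nth_default //.
  case: `|n|%N => [|k]; first by have := size_digit (i := 1) y1; rewrite subn1.
  rewrite -[beta_expansion _ _ _]/(ipart (beta * iter k.+1 (beta_map beta) y)).
  have := @size_digit 1 (iter k.+1 (beta_map beta) y); rewrite subn1; apply.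
  by move=> i i1; rewrite iterS beta_map_coef ifT //; lia.
(* [psi] sends [lz ^+ N] to the inverse of [s ^+ N], and the factor [lz ^+ m.-1] cancels in
   [psi_eval_digit_poly]. *)
exists (lz ^+ N *: digit_poly y).
  by rewrite (leq_trans (size_scale_leq _ _)) // size_poly.
rewrite psi_eval_scale psi_eval_digit_poly // ym rmorph0 mulr0 subr0 /y.
rewrite exprVn mulKf ?expf_neq0 ?lz_neq0 // rmorphXn mulrA -exprMn.
by rewrite -psiT -rmorphM mulfV ?lz_neq0 // rmorph1 expr1n mul1r.
Qed.

End Expansion.

(** * Algebraic series and automatic expansions *)

Section AlgebraicExpansion.
Context {F : finFieldType}.
Local Notation q := (field_order F).
Local Notation tofrac := (@FracField.tofrac {poly F}).
Local Notation alg := (algebraicOver (@rat_invz F)).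
Variables (p e : nat).
Hypotheses (p_prime : prime p) (card_F : q = (p ^ e)%N).
Variables (s : laurent F) (m : nat) (psi : {rmorphism laurent F -> laurent F}).
Hypothesis m_gt0 : (0 < m)%N.
Hypotheses (s_low : vanish_below m%:Z s) (s_neq0 : s m%:Z != 0).
Hypotheses (psiT : psi lz^-1 = s) (psiC : forall k : F, psi k%:A = k%:A).
Hypothesis psi_vanish : forall a (x : laurent F),
  vanish_below a x -> vanish_below (m%:Z * a) (psi x).
Implicit Types (x y : laurent F) (P Q : {poly laurent F}).
Local Notation alg_psi := (algebraicOver (psi \o @rat_invz F)).
Local Notation beta := (s^-1).

Lemma exchange_subst : alg s <-> alg_psi lz^-1.
Proof.
have inj : injective tofrac by move=> c d /eqP; rewrite tofrac_eq => /eqP.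
have iotaE c : rat_invz (tofrac c) = (map_poly (in_alg (laurent F)) c).[lz^-1].
  exact: rat_invz_tofrac.
have psiE c : psi (rat_invz (tofrac c)) = (map_poly (in_alg (laurent F)) c).[s].
  by rewrite rat_invz_tofrac; exact: psi_horner_alg.
split.
  exact: (algebraic_exchange (phi := @rat_invz F) (psi := psi \o @rat_invz F)
    inj (@common_denominator F) iotaE psiE).
exact: (algebraic_exchange (psi := @rat_invz F) (phi := psi \o @rat_invz F)
    inj (@common_denominator F) psiE iotaE).
Qed.

Lemma algebraic_psi x : alg x -> alg_psi (psi x).
Proof. by move=> /(algebraic_rmorph (@rat_invz F) psi). Qed.

(** [psi] maps [F(1/z)] onto [F(s)], which is algebraic over [F(1/z)] when [s] is. *)
Lemma algebraic_of_psi x : alg s -> alg_psi x -> alg x.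
Proof.
move=> algs; apply: algebraic_trans => r /=.
have -> : psi (rat_invz r) =
    horner_alg s \n_(repr r) / horner_alg s \d_(repr r).
  by rewrite /rat_invz fmorph_div !(psi_horner_alg psiT psiC).
have algh c : alg (horner_alg s c).
  apply: algebraic_horner algs => i; rewrite coef_map.
  exact: algebraic_scalar.
exact: algebraic_div.
Qed.

Lemma psi_eval_modp P Q : psi_eval psi Q = 0 ->
  psi_eval psi (P %% Q) = psi_eval psi P.
Proof.
move=> Q0; rewrite {2}(divp_eq P Q) /psi_eval rmorphD rmorphM hornerD hornerM.
by rewrite [X in _ * X]Q0 mulr0 add0r.
Qed.

(* The minimal polynomial of 1/z over the image of psi. *)
Lemma minimal_polynomial : alg s -> exists2 Q : {poly laurent F},
  [/\ Q \is monic, size Q = m.+1 & psi_eval psi Q = 0] & forall i, alg Q`_i.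
Proof.
move=> algs; have surj := psi_eval_surj m_gt0 s_low s_neq0 psiT psiC psi_vanish.
have [P Pm PE] := surj (lz^-1 ^+ m).
pose Q := 'X^m - P.
have szQ : size Q = m.+1 by rewrite size_polyDl size_polyXn // size_polyN ltnS.
have monQ : Q \is monic.
  by rewrite monicE lead_coefDl ?lead_coefXn // size_polyN size_polyXn ltnS.
have Q0 : psi_eval psi Q = 0.
  by rewrite /psi_eval rmorphB /= map_polyXn hornerD hornerN hornerXn -PE subrr.
exists Q => //.
(* The image of [R] annihilates [1/z]; its remainder modulo [Q] has at most [m] coefficients and
   evaluates to [0], so it is zero and [Q] divides that image. *)
have [R R0 Rt] := (exchange_subst.1 algs).
apply: (dvdp_coef_algebraic (phi := @rat_invz F) R0 monQ).
apply/modp_eq0P; set S := map_poly _ R.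
apply: (psi_eval_inj m_gt0 s_low s_neq0 psiT psiC psi_vanish).
  by rewrite -ltnS -szQ ltn_modp monic_neq0.
by rewrite psi_eval_modp // /psi_eval /S -map_poly_comp; exact/eqP.
Qed.

Lemma algebraic_modp (A : fieldType) (incl : {rmorphism A -> laurent F}) P Q :
  (forall x, alg x <-> exists a, incl a = x) ->
  (forall i, alg P`_i) -> (forall i, alg Q`_i) -> forall i, alg (P %% Q)`_i.
Proof.
move=> inclP algP algQ i.
have [P' <-] := map_poly_lift (fun i => (inclP _).1 (algP i)).
have [Q' <-] := map_poly_lift (fun i => (inclP _).1 (algQ i)).
by rewrite -map_modp coef_map; apply/inclP; eexists.
Qed.

Lemma psi_eval_in_alg (c : {poly F}) :
  psi_eval psi (map_poly (in_alg (laurent F)) c) = horner_alg lz^-1 c.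
Proof.
rewrite /psi_eval -map_poly_comp; congr (_.[_]).
by apply: eq_map_poly => k /=; exact: psiC.
Qed.

Lemma expr_frob P n : (size P <= n)%N ->
  P ^+ q = \sum_(k < n) P`_k ^+ q *: 'X^(k * q).
Proof.
move=> Pn; have -> : P = \sum_(k < n) P`_k *: 'X^k.
  rewrite -poly_def; apply/polyP => k; rewrite coef_poly; case: ltnP => // nk.
  by rewrite nth_default // (leq_trans Pn).
rewrite expr_sum_pchar; last first.
  rewrite (eq_pnat _ (pchar_lalg {poly laurent F})).
  exact: card_pchar p_prime card_F _.
apply: eq_bigr => k _; rewrite exprZn -exprM -poly_def coef_poly ltn_ord.
by [].
Qed.

Lemma algebraic_psi_eval_ex x : alg s -> alg x ->
  exists P, [/\ (size P <= m)%N, psi_eval psi P = x & forall i, alg P`_i].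
Proof.
move=> algs algx; have [Q [monQ szQ Q0] algQ] := minimal_polynomial algs.
have surj := psi_eval_surj m_gt0 s_low s_neq0 psiT psiC psi_vanish.
have [A [incl inclP]] := relative_algebraic_closure (@rat_invz F).
have [b [g [d [a [xE gE]]]]] := frobenius_equation p_prime card_F algx.
have algc (c : {poly F}) i : alg (map_poly (in_alg (laurent F)) c)`_i.
  rewrite coef_map; exact: algebraic_scalar.
have size_mod P : (size (P %% Q)%R <= m)%N.
  by rewrite -ltnS -szQ ltn_modp monic_neq0.
have /choice [V VP] : forall i, exists P,
    (size P <= m)%N /\ psi_eval psi P = g ^+ (q ^ i).
  by move=> i; have [P Pm PE] := surj (g ^+ (q ^ i)); exists P.
(* Row [0] is the equation of [g]; for [i > 0] the power [g ^+ (q ^ i)] is itself the term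
   [j = i - 1]. *)
pose C (i j : 'I_d) : {poly F} :=
  if i == 0%N :> nat then a j else (j.+1 == i)%:R%:P.
pose D i j (k : 'I_m) :=
  (map_poly (in_alg (laurent F)) (C i j) * 'X^(k * q)) %% Q.
have algD i j k l : alg (D i j k)`_l.
  apply: (algebraic_modp inclP _ algQ).
  by move=> n; rewrite coefMXn; case: ifP => _; [exact: algebraic0|exact: algc].
(* The coordinates of g ^+ (q ^ i) = sum_j C_ij(1/z) g ^+ (q ^ j.+1), where
   reduction modulo Q brings the degrees in 1/z below m. *)
have VE (i : 'I_d) : V i =
    \sum_(jk : 'I_d * 'I_m) (V jk.1)`_(jk.2) ^+ q *: D i jk.1 jk.2.
  pose W := \sum_j map_poly (in_alg (laurent F)) (C i j) * V j ^+ q.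
  transitivity (W %% Q); last first.
    rewrite /W modp_sum -(pair_bigA _
      (fun (j : 'I_d) (k : 'I_m) => (V j)`_k ^+ q *: D i j k)) /=.
    apply: eq_bigr => j _.
    rewrite (expr_frob (VP j).1) mulr_sumr modp_sum; apply: eq_bigr => k _.
    by rewrite -scalerAr modpZl.
  apply/eqP; rewrite -subr_eq0; apply/eqP.
  apply: (psi_eval_inj m_gt0 s_low s_neq0 psiT psiC psi_vanish).
    rewrite (leq_trans (size_polyD _ _)) // geq_max size_polyN.
    by rewrite (VP i).1 size_mod.
  rewrite /psi_eval rmorphB hornerD hornerN -!/(psi_eval psi _).
  rewrite psi_eval_modp // (VP i).2 /W /psi_eval rmorph_sum horner_sum.
  have step j :
      (map_poly psi
         (map_poly (in_alg (laurent F)) (C i j) * V j ^+ q)).[lz^-1] =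
      horner_alg lz^-1 (C i j) * g ^+ (q ^ j.+1).
    rewrite rmorphM hornerM [X in X * _](psi_eval_in_alg (C i j)).
    by rewrite rmorphXn horner_exp [X in X ^+ q](VP j).2 -exprM -expnSr.
  under eq_bigr do rewrite step.
  apply/eqP; rewrite subr_eq0; apply/eqP; rewrite /C.
  case: (posnP i) => [->|i0]; first by rewrite expn0 expr1 {1}gE.
  have i1 : (i.-1 < d)%N by have := ltn_ord i; lia.
  rewrite (bigD1 (Ordinal i1)) //= prednK // eqxx rmorph1 mul1r.
  rewrite big1 ?addr0 // => j; rewrite -val_eqE /= => ji.
  by rewrite (_ : j.+1 == i = false) ?rmorph0 ?mul0r //; lia.
have algV i l : (i < d)%N -> alg (V i)`_l.
  move=> id; case: (ltnP l m) => [lm|ml]; last first.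
    by rewrite nth_default ?(leq_trans (VP i).1) //; exact: algebraic0.
  have /choice [M ME] : forall ij : ('I_d * 'I_m) * ('I_d * 'I_m),
      exists a, incl a = (D ij.1.1 ij.2.1 ij.2.2)`_(ij.1.2).
    by move=> ij; apply/inclP.
  pose f (il : 'I_d * 'I_m) := (V il.1)`_(il.2).
  have fE il : f il = \sum_(jk : 'I_d * 'I_m) incl (M (il, jk)) * f jk ^+ q.
    rewrite /f VE coef_sum; apply: eq_bigr => jk _.
    by rewrite coefZ ME mulrC.
  have := frobenius_span_algebraic (phi := incl) (f := f)
    (M := fun il jk => M (il, jk))
    (card_pchar p_prime card_F _) (field_order_gt1 F) fE
    (Ordinal id, Ordinal lm).
  by apply: algebraic_trans => c; apply/inclP; exists c.
(* For [d = 0] the equation forces [g = 0]. *)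
pose R := map_poly (in_alg (laurent F)) b * (if (0 < d)%N then V 0%N else 0).
exists (R %% Q); split; first exact: size_mod.
  rewrite psi_eval_modp // /R /psi_eval rmorphM hornerM.
  rewrite [X in X * _](psi_eval_in_alg b) xE; congr (_ * _).
  case: posnP => [d0|_]; last by rewrite [LHS](VP 0%N).2 expn0 expr1.
  rewrite rmorph0 horner0 gE big1 // => -[i lti]; lia.
apply: (algebraic_modp inclP _ algQ) => i.
rewrite coefM; apply: algebraic_sum => k _; apply: algebraic_mul => //.
by case: ifP => [d0|_]; [exact: algV|rewrite coef0; exact: algebraic0].
Qed.

Lemma algebraic_coef_psi_eval P : alg s -> (size P <= m)%N ->
  alg (psi_eval psi P) -> forall i, alg P`_i.
Proof.
move=> algs Pm /(algebraic_psi_eval_ex algs) [R [Rm RP algR]].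
suff -> : P = R by [].
apply/eqP; rewrite -subr_eq0; apply/eqP.
apply: (psi_eval_inj m_gt0 s_low s_neq0 psiT psiC psi_vanish).
  by rewrite (leq_trans (size_polyD _ _)) // geq_max size_polyN Pm.
by move: RP; rewrite /psi_eval rmorphB hornerD hornerN => ->; rewrite subrr.
Qed.

Lemma algebraic_digit_series x k :
  automatic p (beta_expansion beta x) -> alg (digit_series beta x k).
Proof.
move=> /(automatic_map (fun c : {poly F} => c`_k)) autk.
apply: algebraic_mul; first exact: algebraic_lzV.
exact: (algebraic_of_automatic p_prime card_F autk).
Qed.

(* Only the first digit can have degree m. *)
Lemma digit_series_top x : vanish_below 0 x ->
  digit_series beta x m = lz^-1 * ((beta_expansion beta x 1)`_m)%:A.
Proof.
move=> x0; rewrite /digit_series; congr (_ * _); apply/laurentP => n.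
rewrite lcoefZ lcoef1 /=; case: n => [[|n]|n]; rewrite ?mulr1 ?mulr0 //=.
apply: nth_default.
have := size_digit m_gt0 s_low s_neq0 (i := 1)
  (x := iter n.+1 (beta_map beta) x).
rewrite subn1; apply => i i1; rewrite iterS beta_map_coef ifT //; lia.
Qed.

Lemma automatic_algebraic x : alg s -> vanish_below 0 x ->
  automatic p (beta_expansion beta x) <-> alg x.
Proof.
move=> algs x0.
have xE := beta_expansion_series m_gt0 s_low s_neq0 psiT psiC psi_vanish x0.
have algz : alg lz by rewrite -[lz]invrK; apply/algebraic_inv/algebraic_lzV.
split=> [autx|algx].
  rewrite xE; apply: algebraic_sum => k _; apply: algebraic_mul.
    exact: algebraic_exp.
  by apply/(algebraic_of_psi algs)/algebraic_psi/algebraic_digit_series.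
(* The top digit series comes from the first digit alone and is subtracted; the others are
   coordinates of an algebraic element. *)
have algm : alg (digit_series beta x m).
  rewrite digit_series_top //; apply: algebraic_mul; first exact: algebraic_lzV.
  exact: algebraic_scalar.
have algk (k : 'I_m.+1) : alg (digit_series beta x k).
  have := ltn_ord k; rewrite ltnS leq_eqVlt => /orP [/eqP -> //|km].
  have : alg (psi_eval psi (digit_poly s m x)).
    rewrite (psi_eval_digit_poly m_gt0 s_low s_neq0 psiT psiC psi_vanish x0).
    apply: algebraic_mul; first by apply/algebraic_exp/algebraic_lzV.
    apply: algebraic_sub => //.
    apply: algebraic_mul; first exact: algebraic_exp.
    by apply/(algebraic_of_psi algs)/algebraic_psi.
  move=> /(algebraic_coef_psi_eval algs (size_poly _ _)) /(_ (m.-1 - k)%N).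
  by rewrite coef_poly ifT ?subKn //; lia.
(* The digits have degree at most [m], so they are reassembled from [m + 1] automatic coefficient
   sequences. *)
have := automatic_sum (fun k => automatic_map (fun c : F => c *: 'X^k)
  (automatic_of_algebraic p_prime card_F (algk k))).
apply: automatic_eq => n; under eq_bigr do rewrite digit_seriesE.
rewrite -(poly_def _ (fun k => (beta_expansion beta x n.+1)`_k)).
apply/polyP => i; rewrite coef_poly; case: ltnP => // mi.
rewrite nth_default // (leq_trans _ mi) //.
have := size_digit m_gt0 s_low s_neq0 (i := 0) (vanish_iter_beta_map beta n x0).
by rewrite subn0.
Qed.

Lemma algebraic_of_automatic_one :
  automatic p (beta_expansion beta 1) -> alg s.
Proof.
move=> aut1; have v1 : vanish_below 0 (1 : laurent F) by exact: mono_vanish.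
have oneE := beta_expansion_series m_gt0 s_low s_neq0 psiT psiC psi_vanish v1.
(* The expansion of [1] read as an equation for [z]; its degree is exactly [m > 0] because the first
   digit [[beta]] has degree [m]. *)
pose R : {poly laurent F} := \poly_(k < m.+1) psi (digit_series beta 1 k) - 1.
have Rm : R`_m != 0.
  rewrite coefB coef_poly ltnSn coef1 (gtn_eqF m_gt0) subr0 fmorph_eq0.
  rewrite digit_series_top // mulf_neq0 ?invr_neq0 ?lz_neq0 //.
  rewrite scaler_eq0 oner_eq0 orbF /beta_expansion [iter _ _ _]/= mulr1.
  rewrite coef_ipart.
  by have [] := valuation_inv s_low s_neq0.
apply/exchange_subst; apply: algebraic_inv.
apply: (algebraic_root (P := R)).
- by apply: contraNneq Rm => ->; rewrite coef0.
- rewrite rootE hornerD hornerN hornerC subr_eq0 [X in _ == X]oneE horner_poly.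
  by apply/eqP/eq_bigr => k _; rewrite mulrC.
move=> i; rewrite coefB coef_poly; apply: algebraic_sub; last first.
  by rewrite coef1; case: eqP => _; [exact: algebraic1|exact: algebraic0].
case: ifP => _; last exact: algebraic0.
by apply/algebraic_psi/algebraic_digit_series.
Qed.

End AlgebraicExpansion.

Theorem theorem4p1 (p q : nat) (F : finFieldType) (beta : laurent F)
    (p_prime : prime p) (q_pow : exists e : nat, q = (p ^ e)%N)
    (card_F : #|F| = q)
    (beta_deg : exists2 m : int, 0 < m & has_degree beta m) :
  [<-> algebraicOver (@rat_invz F) beta;
       automatic p (beta_expansion beta 1);
       forall x : laurent F, int_series x ->
         (automatic p (beta_expansion beta x) <->
          algebraicOver (@rat_invz F) x)].
Proof.
case: q_pow => e qE; have {}card_F : field_order F = (p ^ e)%N by rewrite -qE.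
case: beta_deg => -[] // m m_gt0 [beta_m beta_low].
have [s_low s_neq0] := valuation_inv beta_low beta_m.
rewrite opprK in s_low s_neq0.
have {}m_gt0 : (0 < m)%N by [].
have [psi [psiT psiC psi_vanish]] := substitution_morphism m_gt0 s_low s_neq0.
have alg_iff (x : laurent F) :
    algebraicOver (@rat_invz F) beta -> vanish_below 0 x ->
    automatic p (beta_expansion beta x) <-> algebraicOver (@rat_invz F) x.
  move=> /algebraic_inv algs; have := automatic_algebraic p_prime card_F m_gt0
    s_low s_neq0 psiT psiC psi_vanish algs (x := x).
  by rewrite invrK.
have alg_beta : automatic p (beta_expansion beta 1) ->
    algebraicOver (@rat_invz F) beta.
  move=> aut1; rewrite -[beta]invrK; apply: algebraic_inv.
  apply: (algebraic_of_automatic_one p_prime card_F m_gt0 s_low s_neq0 psiT psiC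
    psi_vanish).
  by rewrite invrK.
have one0 : vanish_below 0 (1 : laurent F) by exact: mono_vanish.
tfae.
- by move=> algb; apply/alg_iff => //; exact: algebraic1.
- by move=> /alg_beta algb x /int_seriesP; exact: alg_iff.
(* Taking [x = 1], which is algebraic, makes the expansion of [1] automatic. *)
- move=> iff; apply/alg_beta/iff; first exact/int_seriesP.
  exact: algebraic1.
Qed.
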